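(* Let $N\in\mathbb{N}$, let $a_1,\dots,a_N>0$, let $\mu=\sum_{k=1}^Na_k\delta_k$, and let $\check{\mathcal{E}}$, with domain $\check{\mathcal{D}}$, be the trace of the Bessel Dirichlet form $\mathcal{E}$ (case $n=3$) with respect to $\mu$. 1. $\check{\mathcal{D}}=\mathbb{R}^N$ and for each $u=(u_1,\dots,u_N)\in\mathbb{R}^N$ it holds $$\check{\mathcal{E}}[u]=\sum_{k=1}^{N-1}k(k+1)(u_{k+1}-u_k)^2+N\,u_N^2 .$$ 2. $\check{\mathcal{E}}$ is transient and irreducible. 3. $\check{\mathcal{E}}$ is not conservative.
   Context: $\mathbb{N}=\{1,2,\dots\}$ and $I=(0,\infty)$; $AC(I)$ denotes the (locally) absolutely continuous functions on $I$. Let $dm=2x^2\,dx$ on $I$. The Bessel Dirichlet form (case $n=3$) is the form in $L^2(I,m)$ with $$\mathcal{D}=\{u\in AC(I)\cap L^2(I,m):\ \int_0^\infty (u')^2x^2\,dx<\infty\},\qquad \mathcal{E}[u]=\int_0^\infty (u'(x))^2x^2\,dx .$$ For $\lambda>0$, $\mathcal{E}_\lambda[u]=\mathcal{E}[u]+\lambda\int_I u^2\,dm$. Trace with respect to $\mu=\sum_{k=1}^Na_k\delta_k$: let $J:\mathcal{D}\to L^2(\{1,\dots,N\},\mu)\cong\mathbb{R}^N$, $Ju=(u(1),\dots,u(N))$. For $\lambda>0$ let $P_\lambda$ be the orthogonal projection in $(\mathcal{D},\mathcal{E}_\lambda)$ onto the $\mathcal{E}_\lambda$-orthogonal complement of $\ker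 J=\{u\in\mathcal{D}:u(k)=0,\ k=1,\dots,N\}$, and set $\check{\mathcal{E}}_\lambda[Ju]:=\mathcal{E}_\lambda[P_\lambda u]$ for $u\in\mathcal{D}$. These are closed forms, monotone increasing in $\lambda$, and the trace form $\check{\mathcal{E}}$ is by definition the Mosco limit of $\check{\mathcal{E}}_\lambda$ as $\lambda\downarrow0$; it is a Dirichlet form in $L^2(\{1,\dots,N\},\mu)$ with semigroup $\check T_t$. Irreducible: the only sets $Y\subset\{1,\dots,N\}$ with $\check T_t(\mathbf 1_Yf)=\mathbf 1_Y\check T_tf$ for all $f$ and $t>0$ are $\emptyset$ and $\{1,\dots,N\}$. Transient: there is $g>0$ on $\{1,\dots,N\}$ with $\int|u|g\,d\mu\le\sqrt{\check{\mathcal{E}}[u]}$ for all $u\in\check{\mathcal{D}}$. Conservative: $\check T_t1=1$ for some (hence every) $t>0$. *)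

(* Defs.v *)
From HB Require Import structures.
From mathcomp Require Export all_boot all_order all_algebra.
From mathcomp Require Export all_classical all_reals all_analysis.
Export Order.TTheory GRing.Theory Num.Theory.
Export numFieldNormedType.Exports.

Set Implicit Arguments.
Unset Strict Implicit.
Unset Printing Implicit Defensive.

Local Open Scope classical_set_scope.
Local Open Scope ring_scope.

(* Functions on (0, oo) are represented by total functions R -> R; everything
   below only depends on their values on (0, oo). *)

Definition abs_cont {R : realType} (a b : R) (u : R -> R) : Prop :=
  forall e : R, 0 < e -> exists2 d : R, 0 < d &
    forall (m : nat) (s t : 'I_m -> R),
      (forall i, [/\ a <= s i, s i <= t i & t i <= b]) ->
      trivIset setT (fun i => `]s i, t i[%classic) ->
      \sum_(i < m) (t i - s i) < d ->
      \sum_(i < m) `|u (t i) - u (s i)| < e.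

Definition loc_abs_cont {R : realType} (u : R -> R) : Prop :=
  forall a b : R, 0 < a -> a <= b -> abs_cont a b u.

Section bessel.
Variable R : realType.
Local Notation I := (`]0%R, +oo[%classic : set R).
Local Notation leb := (@lebesgue_measure R).

(* u in L^2(I, m), with dm = 2 x^2 dx *)
Definition bessel_L2 (u : R -> R) : Prop :=
  measurable_fun I u /\
  (\int[leb]_(x in I) (u x ^+ 2 * (2 * x ^+ 2))%:E < +oo)%E.

(* [derive1 u x] takes a junk value at points where u is not differentiable, a
   Lebesgue null set when u is locally absolutely continuous. *)
Definition bessel_dom : set (R -> R) :=
  [set u | [/\ loc_abs_cont u, bessel_L2 u &
    (\int[leb]_(x in I) (derive1 u x ^+ 2 * x ^+ 2)%:E < +oo)%E]].

Definition bessel_form (u v : R -> R) : R :=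
  \int[leb]_(x in I) (derive1 u x * derive1 v x * x ^+ 2).

Definition bessel_form_lam (lam : R) (u v : R -> R) : R :=
  bessel_form u v + lam * \int[leb]_(x in I) (u x * v x * (2 * x ^+ 2)).

Definition orth_compl (lam : R) (K : set (R -> R)) : set (R -> R) :=
  [set w | bessel_dom w /\ forall v, K v -> bessel_form_lam lam w v = 0].

(* w is the orthogonal projection of u onto M in (bessel_dom, E_lam); a
   relation, because w is only determined up to its values outside I. *)
Definition is_orth_proj (lam : R) (M : set (R -> R)) (u w : R -> R) : Prop :=
  M w /\ forall v, M v -> bessel_form_lam lam (u \- w) v = 0.

End bessel.

(* L^2({1..N}, mu) with mu = sum_k a_k delta_k is the space of column vectors
   with the inner product [dotmu a]. Indices are shifted: the coordinate of
   k : 'I_N is the one of the point k + 1, and a k is its mass. A form on this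
   space is a map to \bar R, equal to +oo outside its domain. *)

Definition restrict_pts {R : realType} (N : nat) (u : R -> R) : 'cV[R]_N :=
  \col_(k < N) u (k.+1)%:R.

Definition ker_restrict {R : realType} (N : nat) : set (R -> R) :=
  [set u | bessel_dom u /\ restrict_pts N u = 0].

(* E_lam[P_lam u] if f = J u for some u in the domain, +oo otherwise *)
Definition trace_lam {R : realType} (N : nat) (lam : R) (f : 'cV[R]_N) :
    \bar R :=
  xget +oo%E [set e | exists u w : R -> R,
    [/\ bessel_dom u, restrict_pts N u = f,
        is_orth_proj lam (orth_compl lam (ker_restrict N)) u w &
        e = (bessel_form_lam lam w w)%:E]].

Section forms.
Variables (R : realType) (N : nat) (a : 'I_N -> R).
Implicit Types (E : 'cV[R]_N -> \bar R) (f g h : 'cV[R]_N).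

Definition dotmu f g : R := \sum_(k < N) a k * (f k 0 * g k 0).

Definition strong_cvg {T : Type} (F : set_system T) (f_ : T -> 'cV[R]_N) f :
    Prop :=
  dotmu (f_ x - f) (f_ x - f) @[x --> F] --> (0 : R).

Definition weak_cvg {T : Type} (F : set_system T) (f_ : T -> 'cV[R]_N) f :
    Prop :=
  forall g, dotmu (f_ x) g @[x --> F] --> dotmu f g.

(* Mosco convergence of El lam to E as lam decreases to 0 *)
Definition mosco_lim0 (El : R -> 'cV[R]_N -> \bar R) E : Prop :=
  forall lam : nat -> R,
    (forall n, 0 < lam n) -> lam n @[n --> \oo] --> (0 : R) ->
    (forall (f_ : nat -> 'cV[R]_N) f, weak_cvg \oo f_ f ->
       (E f <= limn_einf (fun n => El (lam n) (f_ n)))%E) /\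
    (forall f, exists f_ : nat -> 'cV[R]_N, strong_cvg \oo f_ f /\
       (limn_esup (fun n => El (lam n) (f_ n)) <= E f)%E).

(* the Mosco limit (unique when it exists); +oo everywhere if there is none *)
Definition trace_form : 'cV[R]_N -> \bar R :=
  xget (fun _ => +oo%E) [set E | mosco_lim0 (@trace_lam R N) E].

Definition form_dom E : set 'cV[R]_N := [set f | (E f < +oo)%E].

Definition polar E f g : R := (fine (E (f + g)) - fine (E (f - g))) / 4.

(* f is in the domain of the self-adjoint operator of E, with value h *)
Definition form_op E f h : Prop :=
  form_dom E f /\ forall g, form_dom E g -> polar E f g = dotmu h g.

(* T is the strongly continuous semigroup generated by - (form_op E); only
   its values at t >= 0 matter. *)
Definition is_form_semigroup E (T : R -> 'M[R]_N) : Prop :=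
  [/\ T 0 = 1%:M,
      (forall s t : R, 0 <= s -> 0 <= t -> T (s + t) = T s *m T t),
      (forall f, strong_cvg 0^'+ (fun t => T t *m f) f) &
      (forall f h, form_op E f h <->
         strong_cvg 0^'+ (fun t => t^-1 *: (f - T t *m f)) h)].

(* the identity if E has no semigroup *)
Definition form_semigroup E : R -> 'M[R]_N :=
  xget (fun _ => 1%:M) [set T | is_form_semigroup E T].

Definition mul_indic (Y : {set 'I_N}) f : 'cV[R]_N :=
  \col_k (if k \in Y then f k 0 else 0).

Definition irreducible E : Prop :=
  forall Y : {set 'I_N},
    (forall f (t : R), 0 < t ->
       form_semigroup E t *m mul_indic Y f =
       mul_indic Y (form_semigroup E t *m f)) ->
    Y = finset.set0 \/ Y = [set: 'I_N]%SET.

Definition transient E : Prop :=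
  exists g, (forall k, 0 < g k 0) /\
    forall f, form_dom E f ->
      \sum_(k < N) a k * (`|f k 0| * g k 0) <= Num.sqrt (fine (E f)).

Definition conservative E : Prop :=
  exists2 t : R, 0 < t &
    form_semigroup E t *m const_mx 1 = const_mx 1 :> 'cV[R]_N.

End forms.

(* Main.v *)
From HB Require Import structures.
Require Import Defs.
From mathcomp Require Import ring lra measurable_realfun.

(** The trace form at a positive parameter is explicit.  For [s^2 = 2 lam] the
    function [green s k] lies in the form domain and reproduces the value at
    the point [k] with respect to [E_lam] ([green_reproducing]).  Therefore the
    [E_lam]-orthogonal complement of the functions that vanish at the points
    [1, ..., N] is represented by combinations of the [green s k], and the trace
    form at [lam] is the quadratic form of the inverse of the Gram matrix
    [green s k l] ([trace_lamE]).

    As [lam] decreases to [0] the Gram matrix converges to the matrix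
    [1 / max(k, l)].  The columns of the latter are the reproducing vectors of the
    form in the theorem, by a telescoping sum ([chain_form_invmax]), so its
    inverse is the matrix of that form.  The space is finite-dimensional, so
    convergence of the matrices gives Mosco convergence ([trace_formE]).

    The properties of the limit form [E] are those of a weighted path with a
    killing term at the last point.  The reproducing vectors yield
    [f_l^2 <= E(f)], hence transience.  The semigroup exists as a matrix
    exponential; an invariant set commutes with its generator, so the energy
    between the set and its complement, a sum over the edges that leave the set,
    is zero, which forces the set to be trivial.  Finally the semigroup strictly
    contracts nonzero vectors, because [E] is positive definite, so it cannot
    fix the constant vector.

    Most of the work is in the reproducing property, an integration by parts
    for locally absolutely continuous functions whose derivative exists almost
    everywhere only.  It rests on the fundamental theorem of calculus for
    absolutely continuous functions ([abs_cont_FTC]), obtained from a Jordan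
    decomposition by the total variation, the Radon-Nikodym theorem for the
    Stieltjes measures of the monotone parts, and Lebesgue's differentiation
    theorem.  The boundary terms at [0] and at infinity vanish since a function
    of finite energy grows at most like [1 + 1/x] ([bessel_dom_growth]). *)

Set Implicit Arguments.
Unset Strict Implicit.
Unset Printing Implicit Defensive.

Local Open Scope classical_set_scope.
Local Open Scope ring_scope.

(** * Absolutely continuous functions and total variation *)

Section abs_cont_calculus.
Context {R : realType}.
Implicit Types (a b c d e k : R) (u v w : R -> R).

Definition disjoint_family (T : finType) a b (s t : T -> R) : Prop :=
  (forall i, [/\ a <= s i, s i <= t i & t i <= b]) /\
  trivIset setT (fun i => `]s i, t i[%classic).

(** Families indexed by a dependent sum arise when the intervals of a family
    are subdivided; this form of absolute continuity accepts them directly. *)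
Lemma abs_cont_fin a b u e : abs_cont a b u -> 0 < e ->
  exists2 d : R, 0 < d & forall (T : finType) (s t : T -> R),
    disjoint_family a b s t -> \sum_i (t i - s i) < d ->
    \sum_i `|u (t i) - u (s i)| < e.
Proof.
move=> acu e0; have [d d0 H] := acu e e0; exists d => // T s t [st tr].
rewrite (reindex (@enum_val T predT))/=; last exact/onW_bij/enum_val_bij.
move=> sd; rewrite (reindex (@enum_val T predT))/=; last exact/onW_bij/enum_val_bij.
apply: (H _ (s \o enum_val) (t \o enum_val)) => //.
  by move=> i; exact: st.
move=> i j _ _ /= ij; apply: enum_val_inj; exact: tr.
Qed.

(** All closure properties of absolute continuity used here (sums, products,
    compositions with locally Lipschitz maps, truncations) reduce to this
    comparison of increments. *)
Lemma abs_cont_ctrl a b k u v w : abs_cont a b u -> abs_cont a b v ->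
  (forall x y, a <= x -> x <= y -> y <= b ->
     `|w y - w x| <= k * (`|u y - u x| + `|v y - v x|)) ->
  abs_cont a b w.
Proof.
move=> acu acv wuv e e0.
pose k' := Num.max k 1; have k'0 : 0 < k' by rewrite lt_max ltr01 orbT.
have e'0 : 0 < e / (2 * k') by rewrite divr_gt0// mulr_gt0.
have [d1 d10 H1] := acu _ e'0; have [d2 d20 H2] := acv _ e'0.
exists (Num.min d1 d2); first by rewrite lt_min d10.
move=> m s t st tr; rewrite lt_min => /andP[sd1 sd2].
have {}H1 := H1 _ _ _ st tr sd1; have {}H2 := H2 _ _ _ st tr sd2.
apply: (@le_lt_trans _ _ (k' * (\sum_(i < m) `|u (t i) - u (s i)| +
                                \sum_(i < m) `|v (t i) - v (s i)|))).
  rewrite -big_split/= mulr_sumr ler_sum// => i _.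
  have [as_ st_ tb] := st i; apply: (le_trans (wuv _ _ as_ st_ tb)).
  by rewrite ler_wpM2r ?addr_ge0// le_max lexx.
rewrite (_ : e = k' * (e / (2 * k') + e / (2 * k'))).
  by rewrite ltr_pM2l// ltrD.
by field; exact: lt0r_neq0.
Qed.

Lemma abs_cont_id a b : abs_cont a b id.
Proof.
move=> e e0; exists e => // m s t st _; congr (_ < _).
by apply: eq_bigr => i _; rewrite ger0_norm// subr_ge0; case: (st i).
Qed.

Lemma abs_cont_lip a b k u :
  (forall x y, a <= x -> x <= y -> y <= b -> `|u y - u x| <= k * (y - x)) ->
  abs_cont a b u.
Proof.
move=> ku; have idac := @abs_cont_id a b.
apply: (@abs_cont_ctrl _ _ (`|k|) id id) => // x y ax xy yb.
apply: (le_trans (ku _ _ ax xy yb)).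
have yx : 0 <= y - x by rewrite subr_ge0.
rewrite /= (ger0_norm yx) (@le_trans _ _ (`|k| * (y - x)))//.
  by rewrite ler_wpM2r// ler_norm.
by rewrite ler_wpM2l// lerDl.
Qed.

Lemma abs_contD a b u v : abs_cont a b u -> abs_cont a b v ->
  abs_cont a b (u \+ v).
Proof.
move=> acu acv; apply: (@abs_cont_ctrl _ _ 1 u v) => // x y _ _ _ /=.
rewrite mul1r (_ : u y + v y - _ = (u y - u x) + (v y - v x)); last by ring.
exact: ler_normD.
Qed.

Lemma abs_contB a b u v : abs_cont a b u -> abs_cont a b v ->
  abs_cont a b (u \- v).
Proof.
move=> acu acv; apply: (@abs_cont_ctrl _ _ 1 u v) => // x y _ _ _ /=.
rewrite mul1r (_ : u y - v y - _ = (u y - u x) - (v y - v x)); last by ring.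
exact: ler_normB.
Qed.

(** Subdividing the intervals of a disjoint family gives a disjoint family of
    the same total length, so absolute continuity controls the sum of the
    variations along the subdivisions and not only the sum of the increments. *)
Lemma abs_cont_variation a b u e : abs_cont a b u -> 0 < e ->
  exists2 d : R, 0 < d & forall (T : finType) (s t : T -> R) (l : T -> seq R),
    disjoint_family a b s t -> \sum_i (t i - s i) < d ->
    (forall i, itv_partition (s i) (t i) (l i)) ->
    \sum_i variation (s i) (t i) u (l i) < e.
Proof.
move=> acu e0; have [d d0 H] := abs_cont_fin acu e0.
exists d => // T s t l [st tr] sd pl.
pose K := {i : T & 'I_(size (l i))}.
pose p (i : T) := nth (t i) (s i :: l i).
pose s' (z : K) := p (tag z) (tagged z).
pose t' (z : K) := p (tag z) (tagged z).+1.
have pmono i m1 m2 : (m1 < m2 <= size (l i))%N -> p i m1 < p i m2.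
  move=> /andP[m12 m2l]; rewrite /p.
  have sl : sorted <%R (s i :: l i) by case: (pl i).
  by apply: (sorted_ltn_nth lt_trans (t i) sl) => //;
    rewrite inE/= ltnS// (leq_trans (ltnW m12)).
have pmonoW i m1 m2 : (m1 <= m2 <= size (l i))%N -> p i m1 <= p i m2.
  move=> /andP[]; rewrite leq_eqVlt => /predU1P[->//|m12 m2l].
  by apply/ltW/pmono; rewrite m12.
have pge i m1 : (m1 <= size (l i))%N -> s i <= p i m1.
  by move=> m1l; apply: (pmonoW i 0%N).
have ple i m1 : (m1 <= size (l i))%N -> p i m1 <= t i.
  by move=> m1l; apply: itv_partition_nth_le.
have := H K s' t'.
rewrite (eq_bigr (fun i => \sum_(m < size (l i)) `|u (p i m.+1) - u (p i m)|));
  last by move=> i _; rewrite /variation big_mkord.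
rewrite (@sig_big_dep _ _ _ T (fun i => 'I_(size (l i)))
   xpredT (fun _ _ => true) (fun i (m : 'I_(size (l i))) => `|u (p i m.+1) - u (p i m)|))/=.
apply.
- split=> [[i k]|[i k] [j k'] _ _ /= ikjk'].
    rewrite /s' /t' /=; have [as_ _ tb] := st i; split.
    + by rewrite (le_trans as_)// pge// ltnW.
    + by apply/ltW/pmono; rewrite ltnSn/=.
    + by rewrite (le_trans _ tb)// ple.
  have ij : i = j.
    apply: tr => //; move: ikjk' => [x []].
    rewrite /s' /t'/= !in_itv/= => /andP[x1 x2] /andP[x3 x4].
    exists x; split => /=; rewrite in_itv/=; apply/andP; split.
    + by rewrite (le_lt_trans _ x1)// pge// ltnW.
    + by rewrite (lt_le_trans x2)// ple.
    + by rewrite (le_lt_trans _ x3)// pge// ltnW.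
    + by rewrite (lt_le_trans x4)// ple.
  rewrite -{}ij in k' ikjk' *; congr existT; apply/val_inj.
  move: ikjk' => [x []]; rewrite /s' /t'/= !in_itv/= => /andP[x1 x2] /andP[x3 x4].
  have [kk|kk|//] := ltngtP (val k) (val k').
    have := pmonoW i k.+1 k'; rewrite kk ltnW// => /(_ isT) h.
    by have := lt_trans (lt_le_trans x2 h) x3; rewrite ltxx.
  have := pmonoW i k'.+1 k; rewrite kk ltnW// => /(_ isT) h.
  by have := lt_trans (lt_le_trans x4 h) x1; rewrite ltxx.
rewrite (_ : \sum_(i : K) _ = \sum_i (t i - s i))//.
rewrite -(@sig_big_dep _ _ _ T (fun i => 'I_(size (l i)))
   xpredT (fun _ _ => true) (fun i (m : 'I_(size (l i))) => p i m.+1 - p i m))/=.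
apply: eq_bigr => i _.
have -> : \sum_(j < size (l i)) (p i j.+1 - p i j) =
    \sum_(0 <= j < size (l i)) (p i j.+1 - p i j) by rewrite big_mkord.
by rewrite telescope_sumr// /p (itv_partition_nth_size _ (pl i)).
Qed.

(** Passing to the supremum over subdivisions in the previous lemma: each
    interval receives a subdivision that attains its total variation up to an
    equal share of an arbitrarily small error. *)
Lemma abs_cont_total_variation a b u e : abs_cont a b u -> 0 < e ->
  exists2 d : R, 0 < d & forall (T : finType) (s t : T -> R),
    disjoint_family a b s t -> \sum_i (t i - s i) < d ->
    (\sum_i total_variation (s i) (t i) u <= e%:E)%E.
Proof.
move=> acu e0; have [d d0 H] := abs_cont_variation acu e0.
exists d => // T s t [st tr] sd.
have TVfin i : total_variation (s i) (t i) u \is a fin_num.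
  have [as_ st_ tb] := st i.
  apply/bounded_variationP => //; exists e => _ [l pl <-].
  have := H unit (fun=> s i) (fun=> t i) (fun=> l).
  rewrite !big_const card_unit/= !addr0 => H'; apply/ltW/H' => //.
    split => [_|[] []//]; exact: st.
  apply: le_lt_trans sd; rewrite (bigD1 i)//= lerDl sumr_ge0// => j _.
  by rewrite subr_ge0; case: (st j).
apply/lee_addgt0Pr => h h0.
have h'0 : 0 < h / (#|T|.+1%:R) by rewrite divr_gt0.
have /choice[l ll] : forall i, exists l, itv_partition (s i) (t i) l /\
    (total_variation (s i) (t i) u <= (variation (s i) (t i) u l
       + h / #|T|.+1%:R)%:E)%E.
  move=> i; have [_ /= [x [l pl <-] <-]] := ub_ereal_sup_adherent h'0 (TVfin i).
  move=> hl; exists l; split => //.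
  by rewrite EFinD -leeBlDr// ltW.
have {}H := H T s t l (conj st tr) sd (fun i => (ll i).1).
apply: (@le_trans _ _ (\sum_i (variation (s i) (t i) u (l i) +
    h / #|T|.+1%:R)%:E)%E).
  by apply: lee_sum => i _; exact: (ll i).2.
rewrite sumEFin lee_fin big_split/= lerD ?(ltW H)//.
rewrite sumr_const -[leLHS]mulr_natr mulrAC ler_pdivrMr// ler_wpM2l ?(ltW h0)//.
by rewrite ler_nat ltnW.
Qed.

End abs_cont_calculus.

(** * The Stieltjes measure of a monotone absolutely continuous function *)

Section monotone_abs_cont.
Context {R : realType}.
Implicit Types (a b c d e x y : R) (u v w F : R -> R).
Local Notation leb := (@lebesgue_measure R).

(** Composition with [clamp a b] extends a function on [`[a, b]] to the line by
    constants; it turns an absolutely continuous function on the interval into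
    a continuous function, to which the theory of Stieltjes measures applies. *)
Definition clamp a b x : R := Num.max a (Num.min x b).

Lemma clamp_itv a b x : a <= b -> a <= clamp a b x <= b.
Proof. by move=> ab; rewrite /clamp le_max lexx/= ge_max ab ge_min lexx orbT. Qed.

Lemma clamp_id a b x : a <= x -> x <= b -> clamp a b x = x.
Proof. by move=> ax xb; rewrite /clamp min_l// max_r. Qed.

Lemma clamp_nondecreasing a b : {homo clamp a b : x y / x <= y}.
Proof.
by move=> x y xy; rewrite /clamp ge_max le_max lexx/= le_max;
  apply/orP; right; rewrite le_min !ge_min xy lexx orbT.
Qed.

Lemma clamp_lip a b x y : x <= y -> clamp a b y - clamp a b x <= y - x.
Proof.
move=> xy; rewrite /clamp; case: (leP y b) => ?; case: (leP x b) => ?.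
- by case: (leP a y) => ?; case: (leP a x) => ?; lra.
- by case: (leP a y) => ?; case: (leP a b) => ?; lra.
- by case: (leP a b) => ?; case: (leP a x) => ?; lra.
- by case: (leP a b) => ?; lra.
Qed.

Lemma abs_cont_unif a b u e : abs_cont a b u -> 0 < e ->
  exists2 d : R, 0 < d &
    forall x y, a <= x -> x <= y -> y <= b -> y - x < d -> `|u y - u x| < e.
Proof.
move=> acu e0; have [d d0 H] := abs_cont_fin acu e0; exists d => // x y ax xy yb xyd.
have := H unit (fun=> x) (fun=> y); rewrite !big_const card_unit/= !addr0.
by apply => //; split => [|[] []].
Qed.

Lemma abs_cont_clamp_continuous a b u : a <= b -> abs_cont a b u ->
  continuous (u \o clamp a b).
Proof.
move=> ab acu x; apply/cvgrPdist_lt => e e0.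
have [d d0 H] := abs_cont_unif acu e0.
near=> y; have xyd : `|x - y| < d.
  by near: y; exists d => //= z.
have /andP[ax xb] := clamp_itv x ab; have /andP[ay yb] := clamp_itv y ab.
have [xy|/ltW yx] := leP x y.
  rewrite distrC; apply: H => //; first exact: clamp_nondecreasing.
  by rewrite (le_lt_trans (clamp_lip _ _ xy))// (le_lt_trans _ xyd)// distrC ler_norm.
apply: H => //; first exact: clamp_nondecreasing.
by rewrite (le_lt_trans (clamp_lip _ _ yx))// (le_lt_trans _ xyd)// ler_norm.
Unshelve. all: by end_near. Qed.

Lemma lebesgue_stieltjes_measure_oc (F : cumulative R R) x y : x <= y ->
  lebesgue_stieltjes_measure F `]x, y]%classic = (F y - F x)%:E.
Proof.
move=> xy; rewrite /lebesgue_stieltjes_measure /measure_extension/=.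
by rewrite measurable_mu_extE/= ?wlength_itv_bnd//; exact: is_ocitv.
Qed.

(** A null set [A] has an open neighbourhood [U] of small Lebesgue measure.
    Cut [`]a, b]] into a uniform grid and keep the cells contained in [U]: they
    are disjoint, of small total length, so absolute continuity bounds the
    Stieltjes measure of their union [W n] by [e].  As the grid is refined,
    every point of [A] in [`]a, b]] eventually lies in all [W n], and continuity
    from below along [V n], the intersection of the [W m] with [m >= n], gives
    the same bound for [A]. *)
Lemma nondecreasing_abs_cont_null_dominates a b (F : cumulative R R) :
  a < b -> abs_cont a b F ->
  forall A : set R, measurable A -> leb A = 0%E ->
  lebesgue_stieltjes_measure F (A `&` `]a, b]) = 0%E.
Proof.
move=> ab acF A mA A0; set mu := lebesgue_stieltjes_measure F.
have mAb : measurable (A `&` `]a, b]) by exact: measurableI.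
apply/eqP; rewrite eq_le measure_ge0 andbT; apply/lee_addgt0Pr => e e0; rewrite add0e.
have [d d0 H] := abs_cont_fin acF e0.
have Aoo : (leb A < +oo)%E by rewrite A0.
have [U [oU AU UA]] := lebesgue_regularity_outer mA Aoo d0.
have Ud : (leb U < d%:E)%E.
  have mU := open_measurable oU.
  rewrite -(setDUK AU) (le_lt_trans (measureU2 _ _ _))//; first exact: measurableD.
  by rewrite [X in (X + _)%E](_ : _ = 0%E) ?add0e.
pose h (n : nat) := (b - a) / n.+1%:R.
have h0 n : 0 < h n by rewrite divr_gt0// subr_gt0.
have hn n : a + h n * n.+1%:R = b by rewrite /h mulfVK// addrC subrK.
pose g n (j : nat) := a + h n * j%:R.
have gmono n : {mono g n : i j / (i <= j)%N >-> i <= j}.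
  by move=> i j; rewrite lerD2l ler_pM2l// ler_nat.
pose c n (j : 'I_n.+1) := `[< `]g n j, g n j.+1]%classic `<=` U >].
(* A cell that is not contained in [U] is replaced by the empty [`]a, a]]. *)
pose s n j := if c n j then g n j else a.
pose t n j := if c n j then g n j.+1 else a.
pose W n := \big[setU/set0]_(j < n.+1) `]s n j, t n j]%classic.
have st n j : [/\ a <= s n j, s n j <= t n j & t n j <= b].
  rewrite /s /t; case: ifPn => _; last by split => //; exact: ltW.
  by rewrite gmono leqnSn -[X in X <= _](addr0 a) lerD2l mulr_ge0 ?(ltW (h0 n))//;
    split => //; rewrite -(hn n) -/(g n n.+1) gmono.
have tr n : trivIset setT (fun j => `]s n j, t n j]%classic).
  move=> i j _ _ [x []]/=; rewrite /s /t.
  case: ifPn => _; last by rewrite in_itv/= => /andP[/lt_le_trans] /[apply]; rewrite ltxx.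
  case: ifPn => _; last by rewrite !in_itv/= => _ /andP[/lt_le_trans] /[apply]; rewrite ltxx.
  rewrite !in_itv/= => /andP[x1 x2] /andP[x3 x4]; apply/val_inj => /=.
  have := lt_le_trans x1 x4; have := lt_le_trans x3 x2.
  by rewrite !ltNge !gmono -!ltnNge !ltnS => ji ij; apply/eqP; rewrite eqn_leq ij ji.
have mW n : measurable (W n) by exact: bigsetU_measurable.
have WP n x : W n x <-> exists j, `]s n j, t n j]%classic x.
  rewrite /W -bigcup_seq; split=> [[j _]|[j]] ?; exists j => //=.
  exact: mem_index_enum.
have WU n : W n `<=` U.
  move=> x /WP[j]/=; rewrite /s /t.
  case: ifPn => [/asboolP cU|_]; first exact: cU.
  by rewrite in_itv/= => /andP[/lt_le_trans] /[apply]; rewrite ltxx.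
have muW n : (mu (W n) <= e%:E)%E.
  rewrite /W (_ : mu _ = \sum_(j < n.+1) mu `]s n j, t n j]%classic)%E; last first.
    by apply: measure_semi_additive_ord => //; exact: mW.
  have mui j : mu `]s n j, t n j]%classic = (F (t n j) - F (s n j))%:E.
    by rewrite /mu lebesgue_stieltjes_measure_oc//; case: (st n j).
  rewrite (eq_bigr _ (fun j _ => mui j)) sumEFin lee_fin.
  rewrite (le_trans (ler_norm _))// (le_trans (ler_norm_sum _ _ _))// ltW//.
  apply: H.
    split => // i j _ _ [x [/subset_itv_oo_oc xi /subset_itv_oo_oc xj]].
    by apply: (tr n) => //; exists x.
  have lebWU : (leb (W n) <= leb U)%E.
    by apply: le_measure; [rewrite inE; exact: mW|rewrite inE; exact: open_measurable
      |exact: WU].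
  rewrite -lte_fin (le_lt_trans _ Ud)// (le_trans _ lebWU)//.
  rewrite /W (_ : leb _ = \sum_(j < n.+1) leb `]s n j, t n j]%classic)%E; last first.
    by apply: measure_semi_additive_ord => //; exact: mW.
  rewrite -sumEFin lee_sum// => j _.
  have [_ stj _] := st n j.
  by rewrite lebesgue_measure_itv/= lte_fin; case: ltP => // ts; rewrite lee_fin; lra.
pose V n := \bigcap_(m in [set m | (n <= m)%N]) W m.
have mV n : measurable (V n) by apply: bigcap_measurable => //; exists n => /=.
have ndV : {homo V : n m / (n <= m)%N >-> (n <= m)%O}.
  move=> n m nm; apply/subsetPset => x Vx k /= mk; apply: Vx => /=; exact: leq_trans mk.
have AV : A `&` `]a, b] `<=` \bigcup_n V n.
  move=> x [Ax]; rewrite /= in_itv/= => /andP[ax xb].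
  have [r /= r0 rU] : nbhs x U by apply: open_nbhs_nbhs; split => //; exact: AU.
  have [N bN] : exists N, forall m, (N <= m)%N -> h m < r.
    exists (Num.truncn ((b - a) / r)) => m Nm.
    rewrite /h ltr_pdivrMr// mulrC -ltr_pdivrMr//.
    by rewrite (lt_le_trans (truncnS_gt _))// ler_nat.
  exists N => // m /= Nm.
  (* The cell that contains [x] is the first one whose right end is not below [x]. *)
  have exj : exists j, x <= g m j.+1 by exists m; rewrite /g hn.
  have jm : (ex_minn exj < m.+1)%N.
    by case: ex_minnP => j _ /(_ m); rewrite /g hn ltnS => /(_ xb).
  apply/WP; exists (Ordinal jm) => //.
  rewrite /s /t /c /=; case: ex_minnP jm => j xj minj jm /=.
  have gjx : g m j < x.
    case: j minj {xj jm} => [_|j minj]; first by rewrite /g mulr0 addr0.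
    by rewrite ltNge; apply/negP => /minj; rewrite ltnn.
  rewrite asboolT/=; first by rewrite in_itv/= gjx.
  move=> y /=; rewrite in_itv/= => /andP[gy yg]; apply: rU => /=.
  have gg : g m j.+1 - g m j = h m by rewrite /g -natr1; ring.
  have := bN m Nm; rewrite ltr_norml; lra.
apply: (@le_trans _ _ (mu (\bigcup_n V n))).
  by apply: le_measure; rewrite ?in_setE; [|exact: bigcupT_measurable|].
have /(_ mV) := @nondecreasing_cvg_mu _ _ _ mu V.
move=> /(_ (bigcupT_measurable _ mV) ndV) cV.
apply: (cvge_to_le cV); apply: nearW => n /=.
apply: le_trans (muW n); apply: le_measure; rewrite ?in_setE; [exact: mV|exact: mW|].
by move=> x /(_ n (leqnn n)).
Qed.

End monotone_abs_cont.

(** * The fundamental theorem of calculus for absolutely continuous functions *)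

Section abs_cont_FTC.
Context {R : realType}.
Implicit Types (a b c d e x y : R) (u v w F : R -> R).
Local Notation leb := (@lebesgue_measure R).

Lemma abs_cont_clampl a b u : a <= b -> abs_cont a b u ->
  abs_cont a b (u \o clamp a b).
Proof.
move=> ab acu; apply: (@abs_cont_ctrl _ _ _ 1 u u) => // x y ax xy yb /=.
by rewrite mul1r !clamp_id ?lerDl// ?(le_trans ax)// (le_trans xy).
Qed.

(** The density is the Radon-Nikodym derivative of the Stieltjes measure of
    [F], dominated by [nondecreasing_abs_cont_null_dominates]. *)
Lemma nondecreasing_abs_cont_density a b F : a < b ->
  {in `[a, b] &, nondecreasing_fun F} -> abs_cont a b F ->
  exists2 f : R -> R, leb.-integrable setT (EFin \o f) &
    forall x, a <= x -> x <= b -> F x - F a = \int[leb]_(t in `[a, x]) f t.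
Proof.
move=> ab ndF acF.
pose Fc := F \o clamp a b.
have nd : {homo Fc : x y / x <= y}.
  move=> x y xy; apply: ndF; rewrite ?in_itv/= ?clamp_itv ?(ltW ab)//.
  exact: clamp_nondecreasing.
have rc : right_continuous Fc.
  by apply: right_continuousW; apply: abs_cont_clamp_continuous => //; exact: ltW.
pose G : cumulative R R := HB.pack Fc (isCumulative.Build R _ R Fc nd rc).
have acG : abs_cont a b G by apply: abs_cont_clampl => //; exact: ltW.
pose mu := lebesgue_stieltjes_measure G.
have mD : measurable (`]a, b]%classic : set (measurableTypeR R)) by exact: measurable_itv.
have Doo : (mu `]a, b]%classic < +oo)%E.
  by rewrite /mu lebesgue_stieltjes_measure_oc ?ltry// ltW.
pose nu : {finite_measure set (measurableTypeR R) -> \bar R} := mfrestr mD Doo.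
have nuleb : nu `<< leb.
  apply/null_content_dominatesP => A mA A0.
  exact: (nondecreasing_abs_cont_null_dominates ab acG mA A0).
have [g [g0 gfin ig gE]] := radon_nikodym_sigma_finite nuleb.
have ifg : leb.-integrable setT (EFin \o (fine \o g)).
  by rewrite (_ : EFin \o _ = g)//; apply/funext => x /=; rewrite fineK.
exists (fine \o g) => // x ax xb.
have := gE `]a, x]%classic (measurable_itv _).
rewrite /nu /= /mfrestr /= /mrestr /=.
rewrite (_ : _ `&` _ = `]a, x]%classic); last first.
  apply/seteqP; split => [y []//|y /= yax]; split => //.
  by move: yax; rewrite !in_itv/= => /andP[->]/= /le_trans; exact.
rewrite lebesgue_stieltjes_measure_oc//= /Fc/= !clamp_id//; [|exact: ltW].
move=> FE; rewrite -Rintegral_itv_obnd_cbnd; last exact: integrableS ifg.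
rewrite /Rintegral; under eq_integral do rewrite /= fineK//.
by rewrite -FE.
Qed.

Section total_variation_part.
Variables (a b : R) (u : R -> R).
Hypotheses (ab : a <= b) (acu : abs_cont a b u).

Let V x := fine (total_variation a x u).

(** Induction on the number of steps of length [d / 2], where [d] is such that
    the total variation on intervals shorter than [d] is at most [1]. *)
Lemma abs_cont_bounded_variation : bounded_variation a b u.
Proof.
have [d d0 H] := abs_cont_total_variation acu ltr01.
have K n : forall x, a <= x -> x <= b -> x - a <= n%:R * (d / 2) ->
    total_variation a x u \is a fin_num.
  elim: n => [|n IH] x ax xb xad.
    have -> : x = a by apply/eqP; rewrite eq_le ax andbT -subr_le0 (le_trans xad)// mul0r.
    by rewrite total_variationxx.
  pose y := Num.max a (x - d / 2).
  have ay : a <= y by rewrite le_max lexx.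
  have yx : y <= x by rewrite ge_max ax/= gerBl divr_ge0// ltW.
  have xyd : x - y < d by rewrite /y; case: (leP a (x - d / 2)) => ?; lra.
  rewrite (total_variationD u ay yx) fin_numD IH//=; last 2 first.
    exact: le_trans xb.
    move: xad; rewrite -natr1 mulrDl mul1r => ?.
    have ? : 0 <= n%:R * (d / 2) by rewrite mulr_ge0// divr_ge0// ltW.
    by rewrite /y; case: (leP a (x - d / 2)) => ?; lra.
  rewrite ge0_fin_numE; last exact: total_variation_ge0.
  have := H unit (fun=> y) (fun=> x).
  rewrite !big_const card_unit/= adde0 addr0 => H'; apply: le_lt_trans (ltry 1).
  by apply: H' => //; split => [|[] []].
apply/bounded_variationP => //; apply: (K (Num.truncn ((b - a) / (d / 2))).+1) => //.
by rewrite -ler_pdivrMr ?divr_gt0// ltW// truncnS_gt.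
Qed.

Lemma abs_cont_tv_fin_num x y : a <= x -> x <= y -> y <= b ->
  total_variation x y u \is a fin_num.
Proof.
move=> ax xy yb; apply/bounded_variationP => //.
apply: (bounded_variationr ax xy); apply: bounded_variationl yb _.
  exact: le_trans xy.
exact: abs_cont_bounded_variation.
Qed.

Lemma fine_total_variationB x y : a <= x -> x <= y -> y <= b ->
  V y - V x = fine (total_variation x y u).
Proof.
move=> ax xy yb; rewrite /V (total_variationD u ax xy) fineD ?abs_cont_tv_fin_num//.
  by rewrite addrC addrA addNr add0r.
exact: le_trans yb.
Qed.

Lemma fine_total_variation_ge x y : a <= x -> x <= y -> y <= b ->
  `|u y - u x| <= V y - V x.
Proof.
move=> ax xy yb; rewrite fine_total_variationB//.
by rewrite -lee_fin fineK ?abs_cont_tv_fin_num// total_variation_ge.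
Qed.

Lemma fine_total_variation_abs_cont : abs_cont a b V.
Proof.
move=> e e0; have e20 : 0 < e / 2 by rewrite divr_gt0.
have [d d0 H] := abs_cont_total_variation acu e20.
exists d => // m s t st tr sd.
have stE i : `|V (t i) - V (s i)| = fine (total_variation (s i) (t i) u).
  have [as_ st_ tb] := st i.
  rewrite fine_total_variationB// ger0_norm// fine_ge0// total_variation_ge0//.
rewrite (eq_bigr _ (fun i _ => stE i)) (@le_lt_trans _ _ (e / 2))//; last first.
  by rewrite ltr_pdivrMr// ltr_pMr// ltr1n.
rewrite -lee_fin -sumEFin; have := H _ s t (conj st tr) sd.
rewrite (eq_bigr (fun i => (fine (total_variation (s i) (t i) u))%:E))// => i _.
by have [as_ st_ tb] := st i; rewrite fineK// abs_cont_tv_fin_num.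
Qed.

End total_variation_part.

(** Jordan decomposition: with [V] the total variation of [u], both [V] and
    [V - u] are nondecreasing and absolutely continuous, so both have a density,
    and [u] is the primitive of the difference of the densities.  The
    statement on the derivative is Lebesgue's differentiation theorem. *)
Theorem abs_cont_FTC a b u : a < b -> abs_cont a b u ->
  exists f : R -> R, [/\ leb.-integrable setT (EFin \o f),
    (forall x, a <= x -> x <= b -> u x - u a = \int[leb]_(t in `[a, x]) f t) &
    {ae leb, forall x, a < x < b -> derivable u x 1 /\ derive1 u x = f x}].
Proof.
move=> ab acu; have ab' := ltW ab.
pose V x := fine (total_variation a x u).
have tvB := fine_total_variation_ge ab' acu.
have acV := fine_total_variation_abs_cont ab' acu.
have ndV : {in `[a, b] &, nondecreasing_fun V}.
  move=> x y; rewrite !in_itv/= => /andP[ax xb] /andP[ay yb] xy.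
  by rewrite -subr_ge0 (le_trans _ (tvB _ _ ax xy yb)).
have ndVu : {in `[a, b] &, nondecreasing_fun (V \- u)}.
  move=> x y; rewrite !in_itv/= => /andP[ax xb] /andP[ay yb] xy.
  have := tvB _ _ ax xy yb; rewrite ler_norml /V => /andP[_] ?; lra.
have [f intf fE] := nondecreasing_abs_cont_density ab ndV acV.
have [g intg gE] := nondecreasing_abs_cont_density ab ndVu (abs_contB acV acu).
have ifg : leb.-integrable setT (EFin \o (f \- g)).
  by rewrite (_ : EFin \o _ = (EFin \o f) \- (EFin \o g))%E//; exact: integrableB.
have uE x : a <= x -> x <= b -> u x - u a = \int[leb]_(t in `[a, x]) (f \- g) t.
  move=> ax xb; rewrite RintegralB//; [|exact: integrableS intf|exact: integrableS intg].
  by rewrite -fE// -gE//=; ring.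
exists (f \- g); split => //.
have locfg : locally_integrable setT (f \- g).
  by apply: open_integrable_locally => //; exact: openT.
have ifgy y : leb.-integrable [set` Interval (BLeft a) (BRight y)] (EFin \o (f \- g)).
  exact: integrableS ifg.
have := FTC1 ifgy locfg.
apply: filterS; first exact: (ae_filter_ringOfSetsType leb).
move=> x + /andP[ax xb]; rewrite lte_fin => /(_ ax).
set FF := (fun y => \int[leb]_(t in _) _) => -[dF FE].
have near_eq : \forall y \near x, FF y + u a = u y.
  near=> y; rewrite /FF -uE ?subrK//.
    by apply/ltW; near: y; exact: lt_nbhsr.
  by apply/ltW; near: y; exact: lt_nbhsl.
have dFa : derivable (FF \+ cst (u a)) x 1 by apply: derivableD.
split; first exact: near_eq_derivable near_eq dFa.
have := @near_eq_derive R R R (FF \+ cst (u a)) u x 1 near_eq.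
by rewrite derive1E => <-; rewrite deriveD// derive_cst addr0 -derive1E.
Unshelve. all: by end_near. Qed.

End abs_cont_FTC.

(** * Measurability of the derivative of a continuous function *)

Section measurable_derive1.
Context {R : realType}.
Implicit Types (a b c d e x y h : R) (u v w : R -> R).
Local Notation leb := (@lebesgue_measure R).

(** The proof uses the Cauchy criterion for the difference quotients at [0]:
    [osc u p n] is the set of points where two quotients with increments below
    [1 / n.+1] differ by more than [1 / p.+1].  These sets are open, whence the
    points of differentiability form a Borel set, and there the derivative is
    a pointwise limit of difference quotients. *)
Let diffq u x h : R := h^-1 *: (u (h + x) - u x).

Let pball (n : nat) : set R := [set h | h != 0 /\ `|h| < n.+1%:R^-1].

Let osc u p n : set R :=
  \bigcup_(h in pball n) \bigcup_(k in pball n)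
    [set x | p.+1%:R^-1 < `|diffq u x h - diffq u x k|].

Let continuous_diffq u h : continuous u -> continuous (diffq u ^~ h).
Proof.
move=> cu x; apply: cvgZ; [exact: cvg_cst|]; apply: cvgB; last exact: cu.
apply: (@continuous_comp _ _ _ (fun z => h + z) u); last exact: cu.
by apply: cvgD; [exact: cvg_cst|exact: cvg_id].
Qed.

Let open_osc u p n : continuous u -> open (osc u p n).
Proof.
move=> cu; apply: bigcup_open => h _; apply: bigcup_open => k _.
apply: (@open_comp _ _ (fun x => `|diffq u x h - diffq u x k|) [set y | p.+1%:R^-1 < y]).
  move=> x _; apply: (@continuous_comp _ _ _ (fun x => diffq u x h - diffq u x k)).
    by apply: continuousB; exact: continuous_diffq.
  exact: norm_continuous.
exact: open_gt.
Qed.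

Let derivableE u x :
  cvg (diffq u x @ 0^') <-> forall p, exists n, ~ osc u p n x.
Proof.
split=> [/cvg_ex[/= l /cvgrPdist_lt ql] p|H].
  have p0 : 0 < (p.+1%:R : R)^-1 / 2 by rewrite divr_gt0// invr_gt0.
  have /nbhs_ballP[r /= r0 rq] := ql _ p0.
  exists (Num.truncn r^-1) => -[h [h0 hn] [k [k0 kn]]]/=.
  apply/negP; rewrite -leNgt.
  have small (z : R) : `|z| < (Num.truncn r^-1).+1%:R^-1 -> `|z| < r.
    move/lt_trans; apply; rewrite invf_plt ?posrE//; exact: truncnS_gt.
  have := rq h; rewrite /ball/= sub0r normrN => /(_ (small h hn) h0) qh.
  have := rq k; rewrite /ball/= sub0r normrN => /(_ (small k kn) k0) qk.
  rewrite (_ : _ - _ = (l - diffq u x k) - (l - diffq u x h)); last by ring.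
  by rewrite (le_trans (ler_normB _ _))// ltW// [ltRHS]splitr ltrD.
apply: cauchy_cvg; apply/cauchy_ballP => e e0.
have [n Hn] := H (Num.truncn e^-1).
have nb : \forall h \near (0:R)^', pball n h.
  near=> h; split; near: h; first exact: nbhs_dnbhs_neq.
  by apply: dnbhs0_lt; rewrite invr_gt0.
exists (diffq u x @` pball n, diffq u x @` pball n).
  by split; apply: filterS nb => h hb /=; exists h.
move=> _ /= [[h hb <-] [k kb <-]].
rewrite /ball/= ltNge; apply/negP => eq.
apply: Hn; exists h => //; exists k => //.
rewrite /= (lt_le_trans _ eq)// invf_plt ?posrE//; exact: truncnS_gt.
Unshelve. all: by end_near. Qed.

Lemma continuous_measurable_derive1 u : continuous u -> measurable_fun setT (derive1 u).
Proof.
move=> cu.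
pose D := \bigcap_p \bigcup_n ~` osc u p n.
have mD : measurable D.
  apply: bigcapT_measurable => p; apply: bigcupT_measurable => n.
  by apply: measurableC; apply: open_measurable; exact: open_osc.
have DP x : D x <-> cvg (diffq u x @ 0^').
  rewrite derivableE; split=> [H p|H p _]; last by have [n] := H p; exists n.
  by have [n _] := H p I; exists n.
(* Where the limit of the quotients fails to exist, [derive1] is the constant [point]. *)
pose s n : R := n.+1%:R^-1.
apply: (@measurable_fun_cvg _ R R setT
  (fun n x => \1_D x * diffq u x (s n) + \1_(~` D) x * (point : R)) (derive1 u)).
  move=> n; apply: measurable_funD; apply: measurable_funM => //.
    by apply: continuous_measurable_fun; exact: continuous_diffq.
  exact/measurable_indic/measurableC.
move=> x _; rewrite !indicE in_setC.
have [xD|xD] := boolP (x \in D); last first.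
  rewrite /derive1 dvgP; last by move=> /DP; rewrite notin_setE in xD.
  under eq_fun do rewrite mul0r add0r mul1r.
  exact: cvg_cst.
under eq_fun do rewrite mul1r mul0r addr0.
move: xD; rewrite inE => /DP/cvg_ex[l ql].
rewrite /derive1 (cvg_lim _ ql)//.
by move/cvgr_dnbhsP : ql; apply; split=> [n|]; [rewrite invr_neq0|exact: cvg_harmonic].
Qed.

End measurable_derive1.

(** * Locally absolutely continuous functions on the half-line *)

Section ae_eq_lebesgue.
Context d (T : measurableType d) (R : realType) (mu : {measure set T -> \bar R}).
Variables (D : set T) (f g : T -> R).
Hypotheses (mD : measurable D) (mf : measurable_fun D f) (mg : measurable_fun D g).
Hypothesis fg : {ae mu, forall x, D x -> f x = g x}.

Lemma ae_eq_Rintegral : \int[mu]_(x in D) f x = \int[mu]_(x in D) g x.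
Proof.
congr fine; apply: ae_eq_integral; [|exact/measurable_EFinP..|] => //.
move: fg; apply: filterS.
by move=> x + Dx => /(_ Dx) ->.
Qed.

Lemma ae_eq_integrable : mu.-integrable D (EFin \o f) -> mu.-integrable D (EFin \o g).
Proof.
move=> /integrableP[mf' ifoo]; apply/integrableP; split; first exact/measurable_EFinP.
rewrite (_ : (\int[mu]_(x in D) _)%E = (\int[mu]_(x in D) `|(EFin \o f) x|)%E)//.
apply: ae_eq_integral => //; [exact/measurableT_comp/measurable_EFinP..|].
move: fg; apply: filterS.
by move=> x + Dx => /(_ Dx) /= ->.
Qed.

End ae_eq_lebesgue.

Section loc_abs_cont_theory.
Context {R : realType}.
Implicit Types (a b c d e x y h : R) (u v w : R -> R).
Local Notation leb := (@lebesgue_measure R).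
Local Notation I := (`]0%R, +oo[%classic : set R).

(** The half-line is exhausted by the intervals [J n]; on [J n] a locally
    absolutely continuous function agrees with the continuous function [uJ n],
    so that local properties transfer. *)
Let J (n : nat) : set R := `]n.+1%:R^-1, n.+1%:R[%classic.

Let Jpos n x : J n x -> 0 < x.
Proof. by rewrite /J/= in_itv/= => /andP[+ _]; apply: lt_trans; rewrite invr_gt0. Qed.

Let Jcover x : 0 < x -> exists n, J n x.
Proof.
move=> x0; exists (Num.truncn (Num.max x x^-1)); rewrite /J/= in_itv/=.
have h : Num.max x x^-1 < (Num.truncn (Num.max x x^-1)).+1%:R by exact: truncnS_gt.
by move: h; rewrite {1}gt_max => /andP[-> h2]; rewrite andbT invf_plt ?posrE.
Qed.

Let JE : \bigcup_n J n = I.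
Proof.
apply/seteqP; split => x /=.
  by move=> [n _ /Jpos]; rewrite in_itv/= andbT.
by rewrite in_itv/= andbT => /Jcover[n]; exists n.
Qed.

Let uJ n u := u \o clamp (n.+1%:R^-1) n.+1%:R.

Let near_uJ n u x : J n x -> \forall y \near x, uJ n u y = u y.
Proof.
rewrite /J/= in_itv/= => /andP[x1 x2]; near=> y; rewrite /uJ/= clamp_id//.
  by apply/ltW; near: y; exact: lt_nbhsr.
by apply/ltW; near: y; exact: lt_nbhsl.
Unshelve. all: by end_near. Qed.

Let leJ n : (n.+1%:R : R)^-1 <= n.+1%:R.
Proof. by rewrite (@le_trans _ _ 1)// ?invf_le1// ler1n. Qed.

Let continuous_uJ n u : loc_abs_cont u -> continuous (uJ n u).
Proof.
by move=> acu; apply: abs_cont_clamp_continuous => //; apply: acu => //; rewrite invr_gt0.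
Qed.

Lemma loc_abs_cont_measurable u : loc_abs_cont u -> measurable_fun I u.
Proof.
move=> acu; rewrite -JE; apply/measurable_fun_bigcup => [n|n]; first exact: measurable_itv.
apply: (@eq_measurable_fun _ _ _ _ _ (uJ n u)).
  by move=> x; rewrite inE => Jx; exact: nbhs_singleton (near_uJ u Jx).
by apply: measurable_funTS; apply: continuous_measurable_fun; exact: continuous_uJ.
Qed.

Lemma loc_abs_cont_measurable_derive1 u : loc_abs_cont u -> measurable_fun I (derive1 u).
Proof.
move=> acu; rewrite -JE; apply/measurable_fun_bigcup => [n|n]; first exact: measurable_itv.
apply: (@eq_measurable_fun _ _ _ _ _ (derive1 (uJ n u))).
  move=> x; rewrite inE => Jx; rewrite !derive1E.
  by apply: near_eq_derive; exact: near_uJ.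
apply: measurable_funTS; apply: continuous_measurable_derive1; exact: continuous_uJ.
Qed.

Lemma loc_abs_cont_derivable u : loc_abs_cont u ->
  {ae leb, forall x, I x -> derivable u x 1}.
Proof.
move=> acu.
have H n : {ae leb, forall x, J n x -> derivable u x 1}.
  have [->|n0] := eqVneq n 0%N.
    by apply: aeW => x; rewrite /J/= in_itv/= invr1 => /andP[/lt_trans] /[apply]; rewrite ltxx.
  have ab : (n.+1%:R : R)^-1 < n.+1%:R.
    by rewrite (@lt_trans _ _ 1)// ?invf_lt1// ltr1n ltnS lt0n.
  have [//|f [_ _]] := abs_cont_FTC ab (acu _ _ _ (ltW ab)).
  apply: filterS; first exact: (ae_filter_ringOfSetsType leb).
  by move=> x + Jx; move: Jx; rewrite /J/= in_itv/= => -> /(_ isT)[].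
move/ae_foralln : H; apply: filterS.
by move=> x H; rewrite /= in_itv/= andbT => /Jcover[n]; exact: H.
Qed.

(** The theorem on compact intervals describes the derivative almost everywhere
    in the open interval only, so it is applied on a larger interval. *)
Lemma loc_abs_cont_FTC u a b : loc_abs_cont u -> 0 < a -> a <= b ->
  leb.-integrable `]a, b] (EFin \o derive1 u) /\
  \int[leb]_(x in `]a, b]) derive1 u x = u b - u a.
Proof.
move=> acu a0 ab; set a' := a / 2; set b' := b + 1.
have a'0 : 0 < a' by rewrite divr_gt0.
have aa' : a' < a by rewrite ltr_pdivrMr// ltr_pMr// ltr1n.
have bb' : b < b' by rewrite ltrDl.
have ab' : a' < b' by rewrite (lt_trans aa')// (le_lt_trans ab).
have [f [intf fE dE]] := abs_cont_FTC ab' (acu _ _ a'0 (ltW ab')).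
have md : measurable_fun `]a, b] (derive1 u).
  apply: measurable_funS (loc_abs_cont_measurable_derive1 acu) => //.
  by move=> x /=; rewrite !in_itv/= andbT => /andP[+ _]; exact: lt_trans.
have intf' (i : interval R) : leb.-integrable [set` i] (EFin \o f) by exact: integrableS intf.
have mf : measurable_fun `]a, b] f by have /measurable_int/measurable_EFinP := intf' `]a, b].
have fd : {ae leb, forall x, `]a, b]%classic x -> f x = derive1 u x}.
  move: dE; apply: filterS; first exact: (ae_filter_ringOfSetsType leb).
  move=> x + /=; rewrite in_itv/= => + /andP[ax xb].
  by rewrite (lt_trans aa')// (le_lt_trans xb)// => /(_ isT)[_ ->].
split; first by apply: ae_eq_integrable fd _.
rewrite -(ae_eq_Rintegral _ _ _ fd)// -(@Rintegral_itvB _ _ (BLeft a') (BRight b) a)//;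
  rewrite ?bnd_simp ?(ltW aa')//.
rewrite -fE ?(ltW bb')//; last by rewrite (le_trans (ltW aa')).
by rewrite -fE ?(ltW aa')//; [ring|rewrite (le_trans ab)// ltW].
Qed.

End loc_abs_cont_theory.

(** * The Bessel form domain as a vector space *)

Section square_integrable.
Context d (T : measurableType d) (R : realType) (mu : {measure set T -> \bar R}).
Variable D : set T.
Hypothesis mD : measurable D.
Implicit Types f g : T -> R.

Definition sq_integrable f : Prop :=
  measurable_fun D f /\ mu.-integrable D (fun x => (f x ^+ 2)%:E).

Lemma sq_integrableP f : measurable_fun D f ->
  (\int[mu]_(x in D) (f x ^+ 2)%:E < +oo)%E -> sq_integrable f.
Proof.
move=> mf fo; split => //; apply/integrableP; split.
  by apply/measurable_EFinP; exact: measurable_funX.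
by under eq_integral do rewrite /= ger0_norm ?sqr_ge0//.
Qed.

Lemma sq_integrable_lty f : sq_integrable f ->
  (\int[mu]_(x in D) (f x ^+ 2)%:E < +oo)%E.
Proof.
move=> [_ /integrableP[_]].
by under eq_integral do rewrite /= ger0_norm ?sqr_ge0//.
Qed.

Lemma integrable_le_scaled k f g : measurable_fun D g ->
  (forall x, D x -> `|g x| <= k * f x) -> mu.-integrable D (EFin \o f) ->
  mu.-integrable D (EFin \o g).
Proof.
move=> mg gf intf.
apply: (@le_integrable _ _ _ mu D mD _ (fun x => (k%:E * (f x)%:E)%E)).
- exact/measurable_EFinP.
- by move=> x Dx /=; rewrite lee_fin (le_trans (gf _ Dx))// ler_norm.
- exact: integrableZl.
Qed.

Lemma integrableM_sq f g : sq_integrable f -> sq_integrable g ->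
  mu.-integrable D (fun x => (f x * g x)%:E).
Proof.
move=> [mf intf] [mg intg].
apply: (@integrable_le_scaled 1 (fun x => f x ^+ 2 + g x ^+ 2)).
- exact: measurable_funM.
- move=> x _; rewrite mul1r normrM -(real_normK (num_real (f x))) -(real_normK (num_real (g x))).
  by have := sqr_ge0 (`|f x| - `|g x|);
    have := normr_ge0 (f x); have := normr_ge0 (g x); nra.
- exact: (integrableD mD intf intg).
Qed.

Lemma sq_integrable_lin c f g : sq_integrable f -> sq_integrable g ->
  sq_integrable (fun x => c * f x + g x).
Proof.
move=> [mf intf] [mg intg]; split.
  by apply: measurable_funD => //; exact: measurable_funM.
apply: (@integrable_le_scaled (2 * (c ^+ 2 + 1)) (fun x => f x ^+ 2 + g x ^+ 2)).
- by apply: measurable_funX; apply: measurable_funD => //; exact: measurable_funM.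
- move=> x _; rewrite ger0_norm ?sqr_ge0//.
  have := sqr_ge0 (c * f x - g x); have := sqr_ge0 (c * g x); have := sqr_ge0 (f x).
  by have := sqr_ge0 (g x); nra.
- exact: (integrableD mD intf intg).
Qed.

End square_integrable.

Section ae_mono.
Context d (T : measurableType d) (R : realType) (mu : {measure set T -> \bar R}).

Lemma ae_mono (P Q : T -> Prop) : (forall x, P x -> Q x) ->
  {ae mu, forall x, P x} -> {ae mu, forall x, Q x}.
Proof. by move=> PQ; apply: filterS PQ; exact: (ae_filter_ringOfSetsType mu). Qed.

Lemma ae_mono2 (P P' Q : T -> Prop) : (forall x, P x -> P' x -> Q x) ->
  {ae mu, forall x, P x} -> {ae mu, forall x, P' x} -> {ae mu, forall x, Q x}.
Proof. by move=> PQ; apply: filterS2 PQ; exact: (ae_filter_ringOfSetsType mu). Qed.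

End ae_mono.

Section bessel_space.
Context {R : realType}.
Implicit Types (a b c lam x : R) (u v w : R -> R).
Local Notation leb := (@lebesgue_measure R).
Local Notation I := (`]0%R, +oo[%classic : set R).

Let mI : measurable (I : set (measurableTypeR R)). Proof. exact: measurable_itv. Qed.

(** Absorbing the weight into the function makes the form a pair of Lebesgue
    [L^2] inner products. *)
Lemma bessel_domP u : bessel_dom u <->
  [/\ loc_abs_cont u, sq_integrable leb I (fun x => u x * x) &
      sq_integrable leb I (fun x => derive1 u x * x)].
Proof.
have intE (f : R -> R) : measurable_fun I f ->
    (\int[leb]_(x in I) (f x ^+ 2 * (2 * x ^+ 2))%:E =
     2%:E * \int[leb]_(x in I) ((f x * x) ^+ 2)%:E)%E.
  move=> mf; rewrite -ge0_integralZl_EFin//.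
  - by apply: eq_integral => x _; rewrite -EFinM; congr EFin; ring.
  - by move=> x _; rewrite lee_fin sqr_ge0.
  - by apply/measurable_EFinP/measurable_funX; exact: measurable_funM.
split=> [[acu [mu uo] duo]|[acu su sdu]].
  have mdu := loc_abs_cont_measurable_derive1 acu.
  split => //; apply: sq_integrableP; try exact: measurable_funM.
    move: uo; rewrite intE// => uo.
    rewrite -[ltLHS]mul1e -(mulVf (lt0r_neq0 (ltr0Sn R 1))) EFinM -muleA.
    by rewrite lte_mul_pinfty// lee_fin invr_ge0.
  by under eq_integral do rewrite exprMn.
have mu := loc_abs_cont_measurable acu.
split => //; last by under eq_integral do rewrite -exprMn; exact: sq_integrable_lty sdu.
by split => //; rewrite intE// lte_mul_pinfty// (sq_integrable_lty su).
Qed.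

Lemma abs_cont_bounded a b u : a <= b -> abs_cont a b u ->
  exists M : R, forall x, a <= x -> x <= b -> `|u x| <= M.
Proof.
move=> ab acu; exists (`|u a| + fine (total_variation a b u)) => x ax xb.
have := fine_total_variation_ge ab acu (lexx a) ax xb.
rewrite total_variationxx/= subr0 => h.
have := fine_total_variation_ge ab acu ax xb (lexx b).
rewrite (_ : u x = u a + (u x - u a)); last by ring.
move=> /(le_trans (normr_ge0 _)); rewrite subr_ge0 => h'.
by rewrite (le_trans (ler_normD _ _))// lerD2l (le_trans h).
Qed.

Lemma abs_contM a b u v : a <= b -> abs_cont a b u -> abs_cont a b v ->
  abs_cont a b (fun x => u x * v x).
Proof.
move=> ab acu acv.
have [M uM] := abs_cont_bounded ab acu; have [M' vM] := abs_cont_bounded ab acv.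
have M0 : 0 <= M by exact: le_trans (uM _ (lexx a) ab).
have M'0 : 0 <= M' by exact: le_trans (vM _ (lexx a) ab).
apply: (@abs_cont_ctrl _ _ _ (M + M') u v) => // x y ax xy yb.
rewrite (_ : _ - _ = u y * (v y - v x) + v x * (u y - u x)); last by ring.
rewrite (le_trans (ler_normD _ _))// !normrM.
have := uM y (le_trans ax xy) yb; have := vM x ax (le_trans xy yb).
have := normr_ge0 (u y - u x); have := normr_ge0 (v y - v x).
have := normr_ge0 (u y); have := normr_ge0 (v x).
by nra.
Qed.

Lemma loc_abs_contM u v : loc_abs_cont u -> loc_abs_cont v ->
  loc_abs_cont (fun x => u x * v x).
Proof. by move=> acu acv a b a0 ab; apply: abs_contM => //; [exact: acu|exact: acv]. Qed.

Lemma loc_abs_contD u v : loc_abs_cont u -> loc_abs_cont v ->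
  loc_abs_cont (u \+ v).
Proof. by move=> acu acv a b a0 ab; apply: abs_contD; [exact: acu|exact: acv]. Qed.

Lemma loc_abs_cont_cst c : loc_abs_cont (fun=> c).
Proof.
move=> a b a0 ab; apply: (@abs_cont_lip _ _ _ 0) => x y _ _ _.
by rewrite subrr normr0 mul0r.
Qed.

Lemma loc_abs_cont_lin c u v : loc_abs_cont u -> loc_abs_cont v ->
  loc_abs_cont (fun x => c * u x + v x).
Proof.
move=> acu acv; apply: loc_abs_contD => //.
by apply: loc_abs_contM => //; exact: loc_abs_cont_cst.
Qed.

(** Only almost everywhere: where one of the functions is not differentiable,
    [derive1] takes an arbitrary value and need not be linear. *)
Lemma derive1_lin c u v : loc_abs_cont u -> loc_abs_cont v ->
  {ae leb, forall x, I x ->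
     derive1 (fun x => c * u x + v x) x = c * derive1 u x + derive1 v x}.
Proof.
move=> acu acv.
apply: ae_mono2 (loc_abs_cont_derivable acu) (loc_abs_cont_derivable acv).
move=> x ux vx Ix; have {}ux := ux Ix; have {}vx := vx Ix.
rewrite !derive1E (_ : (fun _ => _) = (c \*: u) \+ v)//.
have cux : derivable (c \*: u) x 1 by exact: derivableZ.
by rewrite (deriveD cux vx) (deriveZ _ ux).
Qed.

Lemma bessel_dom_lin c u v : bessel_dom u -> bessel_dom v ->
  bessel_dom (fun x => c * u x + v x).
Proof.
move=> /bessel_domP[acu su sdu] /bessel_domP[acv sv sdv]; apply/bessel_domP.
have acuv := loc_abs_cont_lin c acu acv.
have mduv := loc_abs_cont_measurable_derive1 acuv.
split => //.
  have := sq_integrable_lin mI c su sv; congr (sq_integrable _ _ _).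
  by apply/funext => x; ring.
have [mc ic] : sq_integrable leb I (fun x => (c * derive1 u x + derive1 v x) * x).
  have := sq_integrable_lin mI c sdu sdv; congr (sq_integrable _ _ _).
  by apply/funext => x; ring.
split; first exact: measurable_funM.
apply: ae_eq_integrable ic => //.
- exact: measurable_funX.
- by apply: measurable_funX; exact: measurable_funM.
- by apply: ae_mono (derive1_lin c acu acv) => x + Ix => ->.
Qed.

Lemma bessel_dom0 : bessel_dom (fun=> 0 : R).
Proof.
have sq0 : sq_integrable leb I (fun=> 0).
  apply: sq_integrableP => //.
  by under eq_integral do rewrite expr0n; rewrite integral0.
apply/bessel_domP; split; first exact: loc_abs_cont_cst.
  by rewrite (_ : (fun x : R => 0 * x) = (fun=> 0))//; apply/funext => x; rewrite mul0r.
rewrite (_ : (fun x : R => derive1 (fun=> 0 : R) x * x) = (fun=> 0))//.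
by apply/funext => x; rewrite derive1_cst mul0r.
Qed.

Lemma bessel_integrable u v : bessel_dom u -> bessel_dom v ->
  leb.-integrable I (EFin \o (fun x => u x * v x * (2 * x ^+ 2))) /\
  leb.-integrable I (EFin \o (fun x => derive1 u x * derive1 v x * x ^+ 2)).
Proof.
move=> /bessel_domP[acu su sdu] /bessel_domP[acv sv sdv]; split.
  rewrite (_ : EFin \o _ = (fun x => 2%:E * (u x * x * (v x * x))%:E)%E).
    exact: (integrableZl mI 2 (integrableM_sq mI su sv)).
  by apply/funext => x /=; rewrite -EFinM; congr EFin; ring.
rewrite (_ : EFin \o _ = (fun x => (derive1 u x * x * (derive1 v x * x))%:E)).
  exact: (integrableM_sq mI sdu sdv).
by apply/funext => x /=; congr EFin; ring.
Qed.

Lemma bessel_form_lamC lam u v : bessel_form_lam lam u v = bessel_form_lam lam v u.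
Proof.
have formC : bessel_form u v = bessel_form v u.
  by apply: eq_Rintegral => x _; rewrite [derive1 u x * _]mulrC.
rewrite /bessel_form_lam formC; congr (_ + lam * _).
by apply: eq_Rintegral => x _; rewrite [u x * _]mulrC.
Qed.

Lemma bessel_form_lam_lin lam c u v w : bessel_dom u -> bessel_dom v -> bessel_dom w ->
  bessel_form_lam lam (fun x => c * u x + v x) w =
  c * bessel_form_lam lam u w + bessel_form_lam lam v w.
Proof.
move=> du dv dw; have [acu _ _] := du; have [acv _ _] := dv; have [acw _ _] := dw.
have [iuw iduw] := bessel_integrable du dw.
have [ivw idvw] := bessel_integrable dv dw.
have mu2 : measurable_fun I (fun x : R => x ^+ 2) by exact: measurable_funX.
have mdu := loc_abs_cont_measurable_derive1 acu.
have mdv := loc_abs_cont_measurable_derive1 acv.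
have mdw := loc_abs_cont_measurable_derive1 acw.
have mduv := loc_abs_cont_measurable_derive1 (loc_abs_cont_lin c acu acv).
have formE : bessel_form (fun x => c * u x + v x) w = c * bessel_form u w + bessel_form v w.
  rewrite /bessel_form -RintegralZl// -RintegralD//; last exact: (integrableZl mI c iduw).
  apply: ae_eq_Rintegral => //.
  - by apply: measurable_funM => //; exact: measurable_funM.
  - apply: measurable_funD; last by apply: measurable_funM => //; exact: measurable_funM.
    by apply: measurable_funM => //; apply: measurable_funM => //; exact: measurable_funM.
  - by apply: ae_mono (derive1_lin c acu acv) => x + Ix => -> //; ring.
have massE : \int[leb]_(x in I) ((c * u x + v x) * w x * (2 * x ^+ 2)) =
    c * \int[leb]_(x in I) (u x * w x * (2 * x ^+ 2)) +
    \int[leb]_(x in I) (v x * w x * (2 * x ^+ 2)).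
  rewrite -RintegralZl// -RintegralD//; last exact: (integrableZl mI c iuw).
  by apply: eq_Rintegral => x _; ring.
rewrite /bessel_form_lam formE massE.
move: (bessel_form u w) (bessel_form v w) => A B.
move: (\int[leb]_(x in I) (u x * w x * (2 * x ^+ 2))) => C.
by move: (\int[leb]_(x in I) (v x * w x * (2 * x ^+ 2))) => D; ring.
Qed.

Lemma bessel_domB u v : bessel_dom u -> bessel_dom v -> bessel_dom (u \- v).
Proof.
move=> du dv; rewrite (_ : u \- v = fun x => -1 * v x + u x); last first.
  by apply/funext => x /=; ring.
exact: bessel_dom_lin.
Qed.

Lemma bessel_form_lamBl lam u v w : bessel_dom u -> bessel_dom v -> bessel_dom w ->
  bessel_form_lam lam (u \- v) w = bessel_form_lam lam u w - bessel_form_lam lam v w.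
Proof.
move=> du dv dw; rewrite (_ : u \- v = fun x => -1 * v x + u x); last first.
  by apply/funext => x /=; ring.
rewrite (bessel_form_lam_lin lam (-1) dv du dw).
by rewrite mulN1r addrC.
Qed.

Lemma bessel_form_lam0l lam w : bessel_dom w -> bessel_form_lam lam (fun=> 0) w = 0.
Proof.
move=> dw; have d0 := bessel_dom0; have := bessel_form_lamBl lam d0 d0 dw.
rewrite subrr (_ : (fun=> 0) \- (fun=> 0) = (fun=> 0))//.
by apply/funext => x /=; rewrite subrr.
Qed.

Lemma bessel_dom_sum n (c : 'I_n -> R) (g : 'I_n -> R -> R) :
  (forall k, bessel_dom (g k)) -> bessel_dom (fun x => \sum_(k < n) c k * g k x).
Proof.
move=> dg; elim: n c g dg => [|n IH] c g dg.
  by under eq_fun do rewrite big_ord0; exact: bessel_dom0.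
by under eq_fun do rewrite big_ord_recl; apply: bessel_dom_lin => //; exact: IH.
Qed.

Lemma bessel_form_lam_suml lam n (c : 'I_n -> R) (g : 'I_n -> R -> R) w :
  (forall k, bessel_dom (g k)) -> bessel_dom w ->
  bessel_form_lam lam (fun x => \sum_(k < n) c k * g k x) w =
  \sum_(k < n) c k * bessel_form_lam lam (g k) w.
Proof.
move=> dg dw; elim: n c g dg => [|n IH] c g dg.
  by under [in LHS]eq_fun do rewrite big_ord0; rewrite big_ord0 bessel_form_lam0l.
pose G x := \sum_(k < n) c (lift ord0 k) * g (lift ord0 k) x.
have dG : bessel_dom G by apply: bessel_dom_sum => k; exact: dg.
rewrite (_ : (fun _ => _) = (fun x => c ord0 * g ord0 x + G x)); last first.
  by apply/funext => x; rewrite big_ord_recl.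
rewrite (bessel_form_lam_lin lam (c ord0) (dg ord0) dG dw) big_ord_recl.
by congr (_ + _); apply: IH => k; exact: dg.
Qed.

End bessel_space.

(** * Examples of locally absolutely continuous functions *)

Section loc_abs_cont_examples.
Context {R : realType}.
Implicit Types (a b c k s x y : R) (u v w : R -> R).

Lemma expRB_le x y : expR x - expR y <= expR x * (x - y).
Proof.
have -> : expR y = expR x * expR (y - x) by rewrite -expRD; congr expR; ring.
rewrite -{1}[expR x]mulr1 -mulrBr ler_wpM2l ?expR_ge0//.
by have := expR_ge1Dx (y - x); lra.
Qed.

Lemma loc_abs_cont_expR u : loc_abs_cont u -> loc_abs_cont (expR \o u).
Proof.
move=> acu a b a0 ab; have [M uM] := abs_cont_bounded ab (acu _ _ a0 ab).
have lip x y : u x <= M -> u y <= M -> `|expR (u y) - expR (u x)| <= expR M * `|u y - u x|.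
  move=> xM yM; wlog xy : x y xM yM / u x <= u y.
    have [xy|/ltW yx] := leP (u x) (u y); first exact.
    by move=> /(_ y x yM xM yx); rewrite distrC [in leRHS]distrC.
  rewrite !ger0_norm ?subr_ge0 ?ler_expR// (le_trans (expRB_le _ _))//.
  by rewrite ler_wpM2r ?subr_ge0// ler_expR.
apply: (@abs_cont_ctrl _ _ _ (expR M) u (fun=> 0)) (acu _ _ a0 ab) _ _.
  exact: loc_abs_cont_cst.
move=> x y ax xy yb; rewrite subrr normr0 addr0 lip//.
  by rewrite (le_trans (ler_norm _))// uM// (le_trans xy).
by rewrite (le_trans (ler_norm _))// uM// (le_trans ax).
Qed.

Lemma loc_abs_cont_inv : loc_abs_cont (fun x : R => x^-1).
Proof.
move=> a b a0 ab; apply: (@abs_cont_lip _ _ _ (a^-1 ^+ 2)) => x y ax xy yb.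
have x0 : 0 < x by exact: lt_le_trans ax.
have y0 : 0 < y by exact: lt_le_trans xy.
rewrite (_ : _ - _ = - (x^-1 * y^-1 * (y - x))); last first.
  by field; rewrite !lt0r_neq0.
rewrite normrN normrM [`|y - x|]ger0_norm ?subr_ge0// ler_wpM2r ?subr_ge0//.
rewrite ger0_norm ?mulr_ge0 ?invr_ge0 ?(ltW x0) ?(ltW y0)// expr2.
by apply: ler_pM; rewrite ?invr_ge0 ?(ltW x0) ?(ltW y0)// lef_pV2 ?posrE// (le_trans ax).
Qed.

Lemma loc_abs_cont_minr k : loc_abs_cont (fun x => Num.min x k).
Proof.
move=> a b a0 ab; apply: (@abs_cont_lip _ _ _ 1) => x y _ xy _.
by rewrite mul1r ger0_norm; case: (leP y k) => ?; case: (leP x k) => ?; lra.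
Qed.

Lemma loc_abs_cont_maxr k : loc_abs_cont (fun x => Num.max x k).
Proof.
move=> a b a0 ab; apply: (@abs_cont_lip _ _ _ 1) => x y _ xy _.
by rewrite mul1r ger0_norm; case: (leP y k) => ?; case: (leP x k) => ?; lra.
Qed.

Lemma loc_abs_cont_id : loc_abs_cont (@id R).
Proof. by move=> a b _ _; exact: abs_cont_id. Qed.

Lemma loc_abs_contZ c u : loc_abs_cont u -> loc_abs_cont (fun x => c * u x).
Proof. by move=> acu; apply: loc_abs_contM => //; exact: loc_abs_cont_cst. Qed.

End loc_abs_cont_examples.

(** * Growth of functions in the form domain *)

Section bessel_growth.
Context {R : realType}.
Implicit Types (a b c k s x y : R) (u v w : R -> R).
Local Notation leb := (@lebesgue_measure R).
Local Notation I := (`]0%R, +oo[%classic : set R).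

Let mitv (i : interval R) : measurable ([set` i] : set (measurableTypeR R)).
Proof. exact: measurable_itv. Qed.

Let oc_sub a b : 0 < a -> (`]a, b] : set R) `<=` I.
Proof. by move=> a0 x /=; rewrite !in_itv/= andbT => /andP[+ _]; exact: lt_trans. Qed.

(** Pointwise [|v'| <= (v' x)^2 + x^-2], and [x^-2] is the derivative of
    [- x^-1]. *)
Lemma bessel_dom_increment v a b : bessel_dom v -> 0 < a -> a <= b ->
  `|v b - v a| <= \int[leb]_(x in I) ((derive1 v x * x) ^+ 2) + a^-1.
Proof.
move=> /bessel_domP[acv _ [mvx ivx]] a0 ab.
have [iv <-] := loc_abs_cont_FTC acv a0 ab.
have [ii iE] := loc_abs_cont_FTC (@loc_abs_cont_inv R) a0 ab.
have dinv x : 0 < x -> derive1 (fun y : R => y^-1) x = - x ^- 2.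
  move=> x0; rewrite derive1E (@derive_val _ _ _ _ _ _ _ (@is_deriveV R id x 1 1 _ _))//.
    by rewrite scaler1.
  by rewrite gt_eqF.
rewrite (le_trans (le_normr_Rintegral _ iv))//.
have ivx' : leb.-integrable `]a, b] (EFin \o (fun x => (derive1 v x * x) ^+ 2)).
  by apply: integrableS ivx => //; exact: oc_sub.
have idB : leb.-integrable `]a, b] (EFin \o (fun x => (derive1 v x * x) ^+ 2
      - derive1 (fun y : R => y^-1) x)).
  exact: (integrableB (mitv _) ivx' ii).
apply: (@le_trans _ _ (\int[leb]_(x in `]a, b])
   ((derive1 v x * x) ^+ 2 - derive1 (fun y : R => y^-1) x))).
  apply: le_Rintegral => //; first exact: (integrable_norm iv).
  move=> x; rewrite /= in_itv/= => /andP[ax _]; have x0 := lt_trans a0 ax.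
  rewrite dinv// opprK exprMn -(real_normK (num_real (derive1 v x))).
  have xV : x * x^-1 = 1 by rewrite divff ?gt_eqF.
  have p : 0 < x^-1 by rewrite invr_gt0.
  rewrite -exprVn; have := sqr_ge0 (`|derive1 v x| * x - x^-1).
  have := normr_ge0 (derive1 v x); nra.
rewrite RintegralB// iE opprB lerD//; last by rewrite gerBl invr_ge0 (le_trans (ltW a0)).
apply: fine_le; [exact: integrable_fin_num ivx'|exact: integrable_fin_num ivx|].
apply: ge0_subset_integral => //; [|by move=> x _; rewrite lee_fin sqr_ge0|exact: oc_sub].
by have /measurable_int := ivx.
Qed.

(** Weak, but enough to kill the boundary terms at [0] and at infinity in the
    integration by parts against a Green function. *)
Lemma bessel_dom_growth v : bessel_dom v ->
  exists2 C : R, 0 <= C & forall x, 0 < x -> `|v x| <= C * (1 + x^-1).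
Proof.
move=> dv; pose E := \int[leb]_(x in I) ((derive1 v x * x) ^+ 2).
have E0 : 0 <= E by apply: Rintegral_ge0 => x _; exact: sqr_ge0.
have C0 : 0 <= `|v 1| + E + 1 by rewrite !addr_ge0.
exists (`|v 1| + E + 1) => // x x0.
have xV0 : 0 < x^-1 by rewrite invr_gt0.
have v0 := normr_ge0 (v 1).
have [x1|/ltW x1] := leP x 1.
  have := bessel_dom_increment dv x0 x1; rewrite -/E distrC => h.
  have := ler_normD (v x - v 1) (v 1); rewrite subrK; nra.
have := bessel_dom_increment dv ltr01 x1; rewrite -/E invr1 => h.
have := ler_normD (v x - v 1) (v 1); rewrite subrK; nra.
Qed.

End bessel_growth.

(** * Radial solutions and the Green function *)

Section radial_solutions.
Context {R : realType}.
Implicit Types (a b c k s x y al be : R) (u v w G : R -> R).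
Local Notation leb := (@lebesgue_measure R).
Local Notation I := (`]0%R, +oo[%classic : set R).

Lemma is_derive_expRM c x : is_derive x 1 (fun y => expR (c * y)) (c * expR (c * x)).
Proof.
have -> : (fun y => expR (c * y)) = expR \o (c \*: (@id R)) by [].
rewrite mulrC; apply: is_derive1_comp.
by apply: is_derive_eq (is_deriveZ c (is_derive_id x 1)) _; rewrite scaler1.
Qed.

(** The substitution [G = phi / x] turns the radial equation
    [(x^2 G')' = s^2 x^2 G] into [phi'' = s^2 phi]; [expsol] is the general
    solution of the latter. *)
Definition expsol s al be x : R := al * expR (s * x) + be * expR (- s * x).

Lemma is_derive_expsol s al be x :
  is_derive x 1 (expsol s al be) (expsol s (s * al) (- s * be) x).
Proof.
have d1 := is_deriveZ al (is_derive_expRM s x).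
have d2 := is_deriveZ be (is_derive_expRM (- s) x).
apply: is_derive_eq (is_deriveD d1 d2) _.
by rewrite /expsol /GRing.scale/=; ring.
Qed.

(** This is [x phi' - phi = x^2 (phi / x)'], the flux of the radial solution
    [phi / x] with [phi = expsol s al be]. *)
Definition expflux s al be x : R := x * expsol s (s * al) (- s * be) x - expsol s al be x.

Lemma is_derive_expflux s al be x :
  is_derive x 1 (expflux s al be) (s ^+ 2 * x * expsol s al be x).
Proof.
have d1 := is_derive_expsol s al be x.
have d2 := is_derive_expsol s (s * al) (- s * be) x.
apply: is_derive_eq (is_deriveB (is_deriveM (is_derive_id x 1) d2) d1) _.
by rewrite /expsol /GRing.scale/=; ring.
Qed.

Lemma derive1_radial s al be G x : 0 < x ->
  (\forall y \near x, G y = expsol s al be y / y) ->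
  derive1 G x = expflux s al be x / x ^+ 2.
Proof.
move=> x0 nG; rewrite derive1E (@near_eq_derive R R R G (fun y => expsol s al be y / y) x 1 nG).
have xn0 : x != 0 by rewrite gt_eqF.
have d1 := is_derive_expsol s al be x.
have d2 : is_derive x 1 (fun y : R => y^-1) (- x ^- 2 *: 1).
  exact: (@is_deriveV R id x 1 1 xn0 (is_derive_id x 1)).
rewrite (@derive_val _ _ _ _ _ _ _ (is_deriveM d1 d2)) /expflux /GRing.scale/=.
by field.
Qed.

Lemma loc_abs_cont_expM c : loc_abs_cont (fun x => expR (c * x)).
Proof. apply: loc_abs_cont_expR; apply: loc_abs_contZ; exact: loc_abs_cont_id. Qed.

Lemma loc_abs_cont_expsol s al be : loc_abs_cont (expsol s al be).
Proof.
by apply: loc_abs_contD; apply: loc_abs_contZ; exact: loc_abs_cont_expM.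
Qed.

Lemma loc_abs_cont_expflux s al be : loc_abs_cont (expflux s al be).
Proof.
rewrite (_ : expflux _ _ _ = fun x => -1 * expsol s al be x +
   x * expsol s (s * al) (- s * be) x); last by apply/funext => x; rewrite /expflux; ring.
apply: loc_abs_cont_lin; first exact: loc_abs_cont_expsol.
by apply: loc_abs_contM; [exact: loc_abs_cont_id|exact: loc_abs_cont_expsol].
Qed.

(** By the radial equation the integrand is the derivative of the flux of [G]
    times [v], an absolutely continuous function. *)
Lemma radial_by_parts s lam al be G v a b : s ^+ 2 = 2 * lam ->
  loc_abs_cont G -> loc_abs_cont v -> 0 < a -> a <= b ->
  (forall x, a < x < b -> G x = expsol s al be x / x) ->
  \int[leb]_(x in `]a, b])
    (derive1 G x * derive1 v x * x ^+ 2 + lam * (G x * v x * (2 * x ^+ 2))) =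
  expflux s al be b * v b - expflux s al be a * v a.
Proof.
move=> slam acG acv a0 ab Gab.
pose F x := expflux s al be x * v x.
have acF : loc_abs_cont F by apply: loc_abs_contM => //; exact: loc_abs_cont_expflux.
have [_ <-] := loc_abs_cont_FTC acF a0 ab.
have sub : (`]a, b] : set R) `<=` I.
  by move=> x /=; rewrite !in_itv/= andbT => /andP[+ _]; exact: lt_trans.
have md w : loc_abs_cont w -> measurable_fun `]a, b] w.
  move=> acw; apply: measurable_funS (loc_abs_cont_measurable acw) => //; exact: measurable_itv.
have mdd w : loc_abs_cont w -> measurable_fun `]a, b] (derive1 w).
  move=> acw; apply: measurable_funS (loc_abs_cont_measurable_derive1 acw) => //; exact: measurable_itv.
have mid : measurable_fun `]a, b] (@id R) by apply: md; exact: loc_abs_cont_id.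
have [mdG mdv] := (mdd _ acG, mdd _ acv); have [mG mv] := (md _ acG, md _ acv).
have mx2 : measurable_fun `]a, b] (fun x : R => x ^+ 2) by exact: measurable_funX.
apply: ae_eq_Rintegral.
- exact: measurable_itv.
- apply: measurable_funD.
    by apply: measurable_funM => //; exact: measurable_funM.
  apply: measurable_funM => //; apply: measurable_funM => //; first exact: measurable_funM.
  exact: measurable_funM.
- exact: mdd.
(* The description of [G] need not hold near the right endpoint [b]. *)
have aeb : {ae leb, forall x : R, x != b}.
  exists [set b]; split; first exact: measurable_set1.
    exact: lebesgue_measure_set1.
  by move=> x /= /negP; rewrite negbK => /eqP.
apply: ae_mono2 aeb (loc_abs_cont_derivable acv) => x xb dv xab.
have := sub _ xab => /dv{}dv; move: xab; rewrite /= in_itv/= => /andP[ax xb'].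
have x0 : 0 < x := lt_trans a0 ax.
have {xb xb'} xb : x < b by rewrite lt_neqAle xb.
rewrite (@derive1_radial s al be G x x0); last first.
  near=> y; apply: Gab; apply/andP; split; near: y; [exact: lt_nbhsr|exact: lt_nbhsl].
have d1 := is_derive_expflux s al be x.
have d2 : is_derive x 1 v (derive1 v x) by rewrite derive1E; exact: derivableP.
rewrite [in RHS]derive1E (@derive_val _ _ _ _ _ _ _ (is_deriveM d1 d2)).
rewrite Gab ?ax//  slam /GRing.scale/=.
by field; rewrite gt_eqF.
Unshelve. all: by end_near. Qed.

End radial_solutions.

Section green.
Context {R : realType}.
Implicit Types (r lam x : R) (u v w : R -> R).
Local Notation leb := (@lebesgue_measure R).
Local Notation I := (`]0%R, +oo[%classic : set R).

(** The [s]-Green function of the Bessel form with pole [k], that is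
    [sinh (s min(x, k)) exp (- s max(x, k)) / (s k x)]. *)
Definition green (s k x : R) : R :=
  (expR (s * Num.min x k) - expR (- s * Num.min x k)) / 2 *
    expR (- s * Num.max x k) / (s * k * x).

Variables s k : R.
Hypotheses (s0 : 0 < s) (k0 : 0 < k).

Let al := expR (- s * k) / (2 * (s * k)).
Let be := (expR (s * k) - expR (- s * k)) / (2 * (s * k)).

Let al0 : 0 < al. Proof. by rewrite divr_gt0 ?expR_gt0 ?mulr_gt0. Qed.

Let be0 : 0 <= be.
Proof.
rewrite divr_ge0 ?mulr_ge0 ?(ltW s0) ?(ltW k0)// subr_ge0 ler_expR mulNr.
by rewrite ge0_cp// mulr_ge0// ltW.
Qed.

(** Near the origin the regular solution [sinh (s x) / x], beyond the pole the
    decaying solution [exp (- s x) / x]. *)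
Lemma green_left x : 0 < x -> x <= k -> green s k x = expsol s al (- al) x / x.
Proof.
move=> x0 xk; rewrite /green min_l// max_r// /expsol /al.
by field; rewrite !gt_eqF.
Qed.

Lemma green_right x : 0 < x -> k <= x -> green s k x = expsol s 0 be x / x.
Proof.
move=> x0 xk; rewrite /green min_r// max_l// /expsol /be.
by field; rewrite !gt_eqF.
Qed.

Lemma greenC l : green s k l = green s l k.
Proof.
rewrite /green minC maxC; congr (_ / _); ring.
Qed.

Lemma loc_abs_cont_green : loc_abs_cont (green s k).
Proof.
have -> : green s k = (fun x => (2 * (s * k))^-1 *
    ((((expR \o (fun x => s * Num.min x k)) \+
       (fun x => -1 * expR (- s * Num.min x k))) x *
      (expR \o (fun x => - s * Num.max x k)) x) * x^-1)).
  by apply/funext => x /=; rewrite /green -[2 * (s * k)]mulrC !invfM; ring.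
apply: loc_abs_contZ; apply: loc_abs_contM; last exact: loc_abs_cont_inv.
apply: loc_abs_contM.
  apply: loc_abs_contD; last apply: loc_abs_contZ;
    by apply: loc_abs_cont_expR; apply: loc_abs_contZ; exact: loc_abs_cont_minr.
by apply: loc_abs_cont_expR; apply: loc_abs_contZ; exact: loc_abs_cont_maxr.
Qed.

Let exp_le x : 0 <= x -> x <= k -> expR (- s * x) <= expR (s * x) /\
  expR (s * x) <= expR (2 * s * k) * expR (- s * x).
Proof.
move=> x0 xk; rewrite -expRD !ler_expR.
have h : s * x <= s * k by rewrite ler_pM2l.
by have h' : 0 <= s * x by [rewrite mulr_ge0// ltW]; split; lra.
Qed.

(** Multiplied by [x], the Green function and its derivative are bounded by a
    multiple of [exp (- s x)], hence square integrable.  On [x <= k] this is a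
    boundedness statement, which is why the factor [exp (2 s k)] appears. *)
Lemma green_le x : 0 < x ->
  `|green s k x * x| <= (be + 2 * al * expR (2 * s * k)) * expR (- s * x).
Proof.
move=> x0; have e0 := expR_ge0 (- s * x); have E0 := expR_ge0 (2 * s * k).
have [xk|/ltW kx] := leP x k.
  have [h1 h2] := exp_le (ltW x0) xk.
  rewrite green_left// mulfVK ?gt_eqF// /expsol.
  have h7 := ler_wpM2l (ltW al0) h1; rewrite ger0_norm; last by lra.
  have h3 := ler_wpM2l (ltW al0) h2; have h4 := mulr_ge0 be0 e0.
  have h5 := mulr_ge0 (ltW al0) e0; have h6 := mulr_ge0 (ltW al0) (mulr_ge0 E0 e0).
  by lra.
rewrite green_right// mulfVK ?gt_eqF// /expsol mul0r add0r (ger0_norm (mulr_ge0 be0 e0)).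
by rewrite ler_wpM2r// lerDl mulr_ge0// mulr_ge0// (ltW al0).
Qed.

Lemma derive1_green_left x : 0 < x -> x < k ->
  derive1 (green s k) x = expflux s al (- al) x / x ^+ 2.
Proof.
move=> x0 xk; apply: derive1_radial => //; near=> y; apply: green_left.
  by near: y; exact: lt_nbhsr.
by apply/ltW; near: y; exact: lt_nbhsl.
Unshelve. all: by end_near. Qed.

Lemma derive1_green_right x : k < x ->
  derive1 (green s k) x = expflux s 0 be x / x ^+ 2.
Proof.
move=> kx; have x0 := lt_trans k0 kx.
apply: derive1_radial => //; near=> y; apply: green_right.
  by near: y; exact: lt_nbhsr.
by apply/ltW; near: y; exact: lt_nbhsr.
Unshelve. all: by end_near. Qed.

(** At [x <= k] the quotient [sinh (s x) / x] stays bounded by convexity of the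
    exponential; the pole itself is excluded since the derivative jumps. *)
Lemma derive1_green_le x : 0 < x -> x != k ->
  `|derive1 (green s k) x * x| <=
  (be * (s + k^-1) + 4 * al * s * expR (2 * s * k)) * expR (- s * x).
Proof.
move=> x0 xk; have e0 := expR_ge0 (- s * x); have E0 := expR_ge0 (2 * s * k).
have kV0 : 0 < k^-1 by rewrite invr_gt0.
have skV0 := addr_ge0 (ltW s0) (ltW kV0).
have t1 : 0 <= be * (s + k^-1) * expR (- s * x) := mulr_ge0 (mulr_ge0 be0 skV0) e0.
have als : 0 <= 4 * al * s by rewrite (mulr_ge0 (mulr_ge0 (ler0n R 4) (ltW al0)))// ltW.
have t2 : 0 <= 4 * al * s * expR (2 * s * k) * expR (- s * x).
  exact: mulr_ge0 (mulr_ge0 als E0) e0.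
rewrite mulrDl; move: xk; rewrite neq_lt => /orP[xk|kx].
  have [h1 h2] := exp_le (ltW x0) (ltW xk).
  rewrite derive1_green_left// (@le_trans _ _ (4 * al * s * expR (s * x)))//; last first.
    rewrite (@le_trans _ _ (4 * al * s * expR (2 * s * k) * expR (- s * x))) ?lerDr//.
    by rewrite -[leRHS]mulrA ler_wpM2l.
  have -> : expflux s al (- al) x / x ^+ 2 * x =
      al * (s * (expR (s * x) + expR (- s * x)) - (expR (s * x) - expR (- s * x)) / x).
    by rewrite /expflux /expsol; field; rewrite gt_eqF.
  have h3 := expRB_le (s * x) (- s * x).
  have h4 : (expR (s * x) - expR (- s * x)) / x <= 2 * s * expR (s * x).
    by rewrite ler_pdivrMr//; apply: (le_trans h3); rewrite le_eqVlt; apply/orP; left;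
      apply/eqP; ring.
  have h5 : 0 <= (expR (s * x) - expR (- s * x)) / x by rewrite divr_ge0 ?(ltW x0)// subr_ge0.
  rewrite normrM (gtr0_norm al0) (_ : 4 * al * s * _ = al * (4 * s * expR (s * x))).
    rewrite (ler_wpM2l (ltW al0))//.
    have h6 := ler_wpM2l (ltW s0) h1; have h7 := mulr_ge0 (ltW s0) e0.
    by rewrite ler_norml; apply/andP; split; lra.
  by ring.
rewrite derive1_green_right// (@le_trans _ _ (be * (s + k^-1) * expR (- s * x))) ?lerDl//.
have -> : expflux s 0 be x / x ^+ 2 * x = - (be * (s + x^-1) * expR (- s * x)).
  by rewrite /expflux /expsol; field; rewrite gt_eqF.
have xV0 : 0 <= x^-1 by rewrite invr_ge0 ltW.
rewrite normrN (ger0_norm (mulr_ge0 (mulr_ge0 be0 (addr_ge0 (ltW s0) xV0)) e0)).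
by rewrite ler_wpM2r// ler_wpM2l// lerD2l lef_pV2 ?posrE// ltW.
Qed.

Let mI : measurable (I : set (measurableTypeR R)). Proof. exact: measurable_itv. Qed.

Lemma integrable_expRN r : 0 < r -> leb.-integrable I (fun x => (expR (- r * x))%:E).
Proof.
move=> r0; have := integrable_exponential_pdf r0.
move=> /(integrableS measurableT mI (@subsetT _ _)) /(integrableZl mI r^-1).
apply: eq_integrable => // x; rewrite inE/= in_itv/= andbT => x0.
by rewrite exponential_pdfE ?(ltW x0)// -EFinM mulKf// gt_eqF.
Qed.

Lemma integrable_sq_exp_bound (f : R -> R) c : measurable_fun I f ->
  {ae leb, forall x, I x -> `|f x| <= c * expR (- s * x)} ->
  sq_integrable leb I f.
Proof.
move=> mf fc; apply: sq_integrableP => //.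
have m2 : measurable_fun I (fun x : R => ((c ^+ 2 * expR (- (2 * s) * x))%:E)%E).
  have /measurable_int := integrableZl mI (c ^+ 2) (integrable_expRN (mulr_gt0 (ltr0Sn R 1) s0)).
  exact.
apply: (@le_lt_trans _ _ (\int[leb]_(x in I) (c ^+ 2 * expR (- (2 * s) * x))%:E)%E).
  apply: ae_ge0_le_integral => //.
  - by move=> x _; rewrite lee_fin sqr_ge0.
  - by apply/measurable_EFinP; exact: measurable_funX.
  - by move=> x _; rewrite lee_fin mulr_ge0 ?sqr_ge0 ?expR_ge0.
  apply: ae_mono fc => x + Ix => /(_ Ix) h.
  rewrite lee_fin -(real_normK (num_real (f x))).
  rewrite (_ : c ^+ 2 * _ = (c * expR (- s * x)) ^+ 2).
    by rewrite ler_sqr ?nnegrE// (le_trans _ h).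
  by rewrite exprMn -expRM_natl; congr (_ * expR _); ring.
have /integrable_lty := integrableZl mI (c ^+ 2) (integrable_expRN (mulr_gt0 (ltr0Sn R 1) s0)).
exact.
Qed.

Lemma bessel_dom_green : bessel_dom (green s k).
Proof.
have acG := loc_abs_cont_green.
have mid : measurable_fun I (@id R) by [].
apply/bessel_domP; split => //.
  apply: (@integrable_sq_exp_bound _ (be + 2 * al * expR (2 * s * k))).
    by apply: measurable_funM => //; exact: loc_abs_cont_measurable.
  by apply: aeW => x; rewrite /= in_itv/= andbT; exact: green_le.
apply: (@integrable_sq_exp_bound _ (be * (s + k^-1) + 4 * al * s * expR (2 * s * k))).
  by apply: measurable_funM => //; exact: loc_abs_cont_measurable_derive1.
exists [set k]; split; [exact: measurable_set1|exact: lebesgue_measure_set1|].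
move=> x /= /existsNP[Ix]; rewrite in_itv/= andbT in Ix.
by apply: contra_notP => /eqP; exact: derive1_green_le.
Qed.

End green.

(** * The reproducing property of the Green function *)

Section exhaustion.
Context {R : realType}.
Local Notation leb := (@lebesgue_measure R).
Local Notation I := (`]0%R, +oo[%classic : set R).

Lemma Rintegral_exhaustion (f : R -> R) (k : R) : 0 < k ->
  leb.-integrable I (EFin \o f) ->
  \int[leb]_(x in `]k / n.+1%:R, k * n.+1%:R]) f x @[n --> \oo] -->
  \int[leb]_(x in I) f x.
Proof.
move=> k0 intf.
have mI : measurable (I : set (measurableTypeR R)) by exact: measurable_itv.
pose D n : set R := `]k / n.+1%:R, k * n.+1%:R]%classic.
have DI n : D n `<=` I.
  move=> x; rewrite /D/= !in_itv/= andbT => /andP[+ _]; apply: lt_trans.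
  by rewrite divr_gt0.
have mf : measurable_fun I (EFin \o f) by exact: measurable_int intf.
have mD n : measurable (D n : set (measurableTypeR R)) by exact: measurable_itv.
have mfD n : measurable_fun I ((EFin \o f) \_ (D n)).
  apply: (measurable_restrict _ (mD n) mI).1.
  by apply: measurable_funS mf => // x [].
have cvgD x : I x -> ((EFin \o f) \_ (D n)) x @[n --> \oo] --> (EFin \o f) x.
  rewrite /= in_itv/= andbT => x0; apply: cvg_near_cst.
  near=> n; rewrite patchE mem_set// /D/= in_itv/=; apply/andP; split.
    rewrite ltr_pdivrMr// mulrC -ltr_pdivrMr//; near: n.
    exists (Num.truncn (k / x)) => // n /= nn.
    by rewrite (lt_le_trans (truncnS_gt _))// ler_nat.
  rewrite mulrC -ler_pdivrMr//; near: n; exists (Num.truncn (x / k)) => // n /= nn.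
  by rewrite ltW// (lt_le_trans (truncnS_gt _))// ler_nat.
have dom n x : I x -> (`|((EFin \o f) \_ (D n)) x| <= (abse \o (EFin \o f)) x)%E.
  by move=> Ix; rewrite patchE; case: ifPn => //= _; rewrite normr0 lee_fin.
have gfin x : I x -> (abse \o (EFin \o f)) x \is a fin_num by [].
have := @dominated_cvg _ _ _ leb I mI _ _ _ mfD cvgD gfin (integrable_abse intf) dom.
rewrite [X in _ --> X](_ : _ = (\int[leb]_(x in I) f x)%:E); last first.
  by rewrite /Rintegral fineK//; exact: integrable_fin_num.
move=> /fine_cvg; apply: cvg_trans; apply: near_eq_cvg; apply: nearW => n /=.
by rewrite /Rintegral -integral_mkcondr setIidr.
Unshelve. all: by end_near. Qed.

End exhaustion.

Lemma is_derive_cvg (R : realType) (f : R -> R) (x l : R) : is_derive x 1 f l ->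
  h^-1 *: (f (h + x) - f x) @[h --> 0^'] --> l.
Proof.
move=> [df <-]; rewrite -derive1E /derive1.
have dE : (fun h : R => h^-1 *: ((f \o shift x) (h *: 1) - f x)) =
    (fun h : R => h^-1 *: (f (h + x) - f x)).
  by apply/funext => h; rewrite /= [h%:A]mulr1.
have : cvg ((fun h : R => h^-1 *: ((f \o shift x) (h *: 1) - f x)) @ 0^') := df.
by rewrite dE.
Qed.

Section reproducing.
Context {R : realType}.
Implicit Types (lam x : R) (u v w : R -> R).
Local Notation leb := (@lebesgue_measure R).
Local Notation I := (`]0%R, +oo[%classic : set R).
Variables s k lam : R.
Hypotheses (s0 : 0 < s) (k0 : 0 < k) (slam : s ^+ 2 = 2 * lam).

(** The flux of the regular solution vanishes at [0] together with its
    derivative, so it is [o(x)], whereas [v] is [O(1/x)]. *)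
Lemma expflux_cvg0 al v : bessel_dom v ->
  expflux s al (- al) (k / n.+1%:R) * v (k / n.+1%:R) @[n --> \oo] --> 0.
Proof.
move=> dv; have [C C0 vC] := bessel_dom_growth dv.
pose a n : R := k / n.+1%:R.
have a0 n : 0 < a n by rewrite divr_gt0.
have acvg : a n @[n --> \oo] --> 0.
  by rewrite -(mulr0 k); apply: cvgM; [exact: cvg_cst|exact: cvg_harmonic].
pose p := expflux s al (- al).
have p0 : p 0 = 0 by rewrite /p /expflux /expsol !mulr0 expR0; ring.
have qcvg : (a n)^-1 * p (a n) @[n --> \oo] --> 0.
  have := is_derive_cvg (is_derive_expflux s al (- al) 0).
  rewrite mulr0 mul0r.
  move=> /cvgr_dnbhsP H; have an0 n : a n != 0 by rewrite gt_eqF.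
  have := H a (conj an0 acvg); rewrite /GRing.scale/= -/p.
  by under eq_fun do rewrite addr0 p0 subr0.
apply/norm_cvg0P; apply: (@squeeze_cvgr _ _ _ _ (fun=> 0)
  (fun n => `|(a n)^-1 * p (a n)| * (C * (k + 1)))).
- near=> n; rewrite normr_ge0/=.
  have -> : expflux s al (- al) (k / n.+1%:R) * v (k / n.+1%:R) =
      (a n)^-1 * p (a n) * (a n * v (a n)).
    by rewrite [RHS]mulrACA mulVf ?mul1r// gt_eqF.
  rewrite normrM ler_wpM2l// normrM gtr0_norm//.
  rewrite (le_trans (ler_wpM2l (ltW (a0 n)) (vC _ (a0 n))))//.
  rewrite mulrCA ler_wpM2l// mulrDr mulr1 divff ?gt_eqF// lerD2r.
  by rewrite ler_pdivrMr// ler_peMr ?(ltW k0)// ler1n.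
- exact: cvg_cst.
- rewrite -[X in _ --> X](mul0r (C * (k + 1))); apply: cvgM; last exact: cvg_cst.
  exact/norm_cvg0P.
Unshelve. all: by end_near. Qed.

(** The flux decays exponentially, and [v] is bounded on [`[k, +oo[]. *)
Lemma expflux_cvgy be v : bessel_dom v ->
  expflux s 0 be (k * n.+1%:R) * v (k * n.+1%:R) @[n --> \oo] --> 0.
Proof.
move=> dv; have [C C0 vC] := bessel_dom_growth dv.
pose M := `|be| * (4 / (s * k)) * (C * (1 + k^-1)).
apply/norm_cvg0P; apply: (@squeeze_cvgr _ _ _ _ (fun=> 0) (fun n => M * n.+1%:R^-1)).
- near=> n; rewrite normr_ge0/=; set b := k * n.+1%:R.
  have b0 : 0 < b by rewrite mulr_gt0.
  have kb : k <= b by rewrite ler_peMr ?(ltW k0)// ler1n.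
  have vb : `|v b| <= C * (1 + k^-1).
    by rewrite (le_trans (vC _ b0))// ler_wpM2l// lerD2l lef_pV2.
  have sb : 0 < s * b by rewrite mulr_gt0.
  have pb : `|expflux s 0 be b| <= `|be| * (4 / (s * k)) * n.+1%:R^-1.
    rewrite (_ : expflux s 0 be b = - (be * ((s * b + 1) * expR (- (s * b))))); last first.
      by rewrite -[in RHS](mulNr s b) /expflux /expsol; ring.
    rewrite normrN normrM -!mulrA ler_wpM2l//.
    rewrite ger0_norm ?mulr_ge0 ?expR_ge0 ?addr_ge0 ?(ltW sb)//.
    rewrite (_ : 4 * _ = 4 / (s * b)); last first.
      by rewrite /b; field; rewrite !gt_eqF.
    rewrite expRN ler_pdivrMr ?expR_gt0// mulrAC ler_pdivlMr//.
    have := expR_ge1Dxn 1 (ltW sb); rewrite (_ : 2`! = 2%N)// => h.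
    rewrite (@le_trans _ _ (4 * (1 + (s * b) ^+ 2 / 2%:R)))//; last by rewrite ler_wpM2l.
    by nra.
  rewrite normrM /M [leRHS]mulrAC.
  by apply: ler_pM.
- exact: cvg_cst.
- by rewrite -(mulr0 M); apply: cvgM; [exact: cvg_cst|exact: cvg_harmonic].
Unshelve. all: by end_near. Qed.

(** Integrate by parts on [`[a, k]] and on [`[k, b]].  The boundary terms at [a] and
    [b] vanish in the limit, and at the pole the flux jumps by [1]. *)
Lemma green_reproducing v : bessel_dom v ->
  bessel_form_lam lam (green s k) v = v k.
Proof.
move=> dv; have dg := bessel_dom_green s0 k0.
have [acg _ _] := dg; have [acv _ _] := dv.
have [ig idg] := bessel_integrable dg dv.
have mI : measurable (I : set (measurableTypeR R)) by exact: measurable_itv.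
pose f x := derive1 (green s k) x * derive1 v x * x ^+ 2 +
  lam * (green s k x * v x * (2 * x ^+ 2)).
have intf : leb.-integrable I (EFin \o f).
  exact: (integrableD mI idg (integrableZl mI lam ig)).
have formE : bessel_form_lam lam (green s k) v = \int[leb]_(x in I) f x.
  rewrite /bessel_form_lam /bessel_form -RintegralZl// -RintegralD//.
  exact: (integrableZl mI lam ig).
rewrite formE.
have := Rintegral_exhaustion k0 intf => /cvg_lim <-//; apply: cvg_lim => //.
pose al := expR (- s * k) / (2 * (s * k)).
pose be := (expR (s * k) - expR (- s * k)) / (2 * (s * k)).
pose pL := expflux s al (- al); pose pR := expflux s 0 be.
have jump : pL k - pR k = 1.
  have e : expR (s * k) * expR (- s * k) = 1 by rewrite mulNr expRxMexpNx_1.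
  rewrite /pL /pR /expflux /expsol /al /be mul0r mulr0 mul0r.
  transitivity (expR (s * k) * expR (- s * k)); last exact: e.
  by field; rewrite !gt_eqF.
have E n : \int[leb]_(x in `]k / n.+1%:R, k * n.+1%:R]) f x =
    v k - pL (k / n.+1%:R) * v (k / n.+1%:R) + pR (k * n.+1%:R) * v (k * n.+1%:R).
  set a := k / n.+1%:R; set b := k * n.+1%:R.
  have a0 : 0 < a by rewrite divr_gt0.
  have ak : a <= k by rewrite ler_pdivrMr// ler_peMr ?(ltW k0)// ler1n.
  have kb : k <= b by rewrite ler_peMr ?(ltW k0)// ler1n.
  have intab : leb.-integrable [set` Interval (BRight a) (BRight b)] (EFin \o f).
    apply: (integrableS mI _ _ intf); first exact: measurable_itv.
    by move=> x /=; rewrite !in_itv/= andbT => /andP[+ _]; exact: lt_trans.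
  have := Rintegral_itvB intab ak kb => /eqP; rewrite subr_eq => /eqP ->.
  rewrite /f (radial_by_parts slam acg acv k0 kb (al := 0) (be := be)); last first.
    by move=> x /andP[kx _]; have x0 := lt_trans k0 kx; rewrite green_right// ltW.
  rewrite (radial_by_parts slam acg acv a0 ak (al := al) (be := - al)); last first.
    by move=> x /andP[ax xk]; have x0 := lt_trans a0 ax; rewrite green_left// ltW.
  rewrite -/pL -/pR -[v k in RHS]mul1r -jump; ring.
rewrite (funext E).
have : v k - pL (k / n.+1%:R) * v (k / n.+1%:R) + pR (k * n.+1%:R) * v (k * n.+1%:R)
    @[n --> \oo] --> v k - 0 + 0.
  apply: cvgD; last exact: expflux_cvgy.
  by apply: cvgB; [exact: cvg_cst|exact: expflux_cvg0].
by rewrite subr0 addr0.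
Qed.

End reproducing.

(** * Entrywise limits of matrices *)

Section entrywise_limits.
Context {R : realType} {T : Type} {F : set_system T} {FF : Filter F}.

Lemma cvg_sumr (I : Type) (r : seq I) (P : pred I) (f : I -> T -> R) (l : I -> R) :
  (forall i, P i -> f i x @[x --> F] --> l i) ->
  \sum_(i <- r | P i) f i x @[x --> F] --> \sum_(i <- r | P i) l i.
Proof. by move=> fl; apply: cvg_big => //; exact: add_continuous. Qed.

Lemma cvg_prodr (I : Type) (r : seq I) (P : pred I) (f : I -> T -> R) (l : I -> R) :
  (forall i, P i -> f i x @[x --> F] --> l i) ->
  \prod_(i <- r | P i) f i x @[x --> F] --> \prod_(i <- r | P i) l i.
Proof. by move=> fl; apply: cvg_big => //; exact: mul_continuous. Qed.

Definition entry_cvg m n (A_ : T -> 'M[R]_(m, n)) (A : 'M[R]_(m, n)) : Prop :=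
  forall i j, A_ x i j @[x --> F] --> A i j.

Lemma entry_cvgM m n p (A_ : T -> 'M[R]_(m, n)) A (B_ : T -> 'M[R]_(n, p)) B :
  entry_cvg A_ A -> entry_cvg B_ B -> entry_cvg (fun x => A_ x *m B_ x) (A *m B).
Proof.
move=> AA BB i j; rewrite mxE; under eq_fun do rewrite mxE.
by apply: cvg_sumr => k _; apply: cvgM; [exact: AA|exact: BB].
Qed.

Lemma entry_cvg_det n (A_ : T -> 'M[R]_n) A : entry_cvg A_ A ->
  \det (A_ x) @[x --> F] --> \det A.
Proof.
move=> AA; apply: cvg_sumr => t _; apply: cvgM; first exact: cvg_cst.
by apply: cvg_prodr => i _; exact: AA.
Qed.

Lemma entry_cvg_invmx n (A_ : T -> 'M[R]_n) A : entry_cvg A_ A -> A \in unitmx ->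
  (\forall x \near F, A_ x \in unitmx) /\
  entry_cvg (fun x => invmx (A_ x)) (invmx A).
Proof.
move=> AA uA; have dA := entry_cvg_det AA.
have dA0 : \det A != 0 by move: uA; rewrite unitmxE unitfE.
have uA_ : \forall x \near F, A_ x \in unitmx.
  apply: filterS (cvgr_neq0 _ dA dA0) => x; by rewrite unitmxE unitfE.
split => // i j; rewrite /invmx uA !mxE.
have : (\det (A_ x))^-1 * cofactor (A_ x) j i @[x --> F] -->
    (\det A)^-1 * cofactor A j i.
  apply: cvgM; first exact: cvgV.
  apply: cvgM; first exact: cvg_cst.
  by apply: entry_cvg_det => k l; rewrite !mxE; under eq_fun do rewrite !mxE; exact: AA.
apply: cvg_trans; apply: near_eq_cvg; apply: filterS uA_ => x ux.
by rewrite ux !mxE.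
Qed.

End entrywise_limits.

(** * The trace forms at positive parameter *)

Section trace.
Context {R : realType}.
Implicit Types (s lam : R) (u v w : R -> R).

Definition green_mx N s : 'M[R]_N := \matrix_(k, l) green s k.+1%:R l.+1%:R.

(** The combination [w0] of Green functions that takes the values [f] at the
    points is orthogonal to the kernel of the restriction, by the reproducing
    property, so it is the projection of any extension of [f]; its energy is
    the quadratic form of the inverse Gram matrix.  Since [trace_lam] speaks of
    any extension [u] and any projection [w] of it, the energy of [w] is
    computed by [E(w, w) = E(u, w) = E(w0, w) = E(w0, u)]. *)
Lemma trace_lamE N s lam (f : 'cV[R]_N) : 0 < s -> s ^+ 2 = 2 * lam ->
  green_mx N s \in unitmx ->
  trace_lam lam f = (\sum_(k < N) (invmx (green_mx N s) *m f) k 0 * f k 0)%:E.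
Proof.
move=> s0 slam uG; set c := invmx (green_mx N s) *m f.
have k0 (k : 'I_N) : 0 < (k.+1%:R : R) by [].
pose g (k : 'I_N) := green s k.+1%:R.
have dg k : bessel_dom (g k) by exact: bessel_dom_green.
pose w0 x := \sum_(k < N) c k 0 * g k x.
have dw0 : bessel_dom w0 by exact: bessel_dom_sum.
have Ew0 v : bessel_dom v -> bessel_form_lam lam w0 v = \sum_(k < N) c k 0 * v k.+1%:R.
  move=> dv; rewrite /w0 (bessel_form_lam_suml lam (fun k => c k 0) dg dv).
  by apply: eq_bigr => k _; rewrite /g green_reproducing.
have Jw0 : restrict_pts N w0 = f.
  apply/colP => l; rewrite mxE.
  have -> : f = green_mx N s *m c by rewrite /c mulKVmx.
  by rewrite [RHS]mxE; apply: eq_bigr => k _; rewrite [green_mx _ _ _ _]mxE mulrC /g greenC.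
have Mw0 : orth_compl lam (ker_restrict N) w0.
  split => // v [dv Jv]; rewrite Ew0// big1// => k _.
  have : restrict_pts N v k 0 = 0 by rewrite Jv mxE.
  by rewrite mxE => ->; rewrite mulr0.
have EJ u : bessel_dom u -> restrict_pts N u = f ->
    bessel_form_lam lam w0 u = \sum_(k < N) c k 0 * f k 0.
  by move=> du <-; rewrite Ew0//; apply: eq_bigr => k _; rewrite [restrict_pts _ _ _ _]mxE.
have val e : (exists u w : R -> R, [/\ bessel_dom u, restrict_pts N u = f,
      is_orth_proj lam (orth_compl lam (ker_restrict N)) u w &
      e = (bessel_form_lam lam w w)%:E]) -> e = (\sum_(k < N) c k 0 * f k 0)%:E.
  move=> [u [w [du Ju [[dw ow] uw] ->]]]; congr EFin.
  have uwv v : orth_compl lam (ker_restrict N) v ->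
      bessel_form_lam lam w v = bessel_form_lam lam u v.
    move=> Mv; have := uw v Mv; have [dv _] := Mv.
    by rewrite (bessel_form_lamBl lam du dw dv) => /eqP; rewrite subr_eq0 => /eqP.
  have kuw0 : ker_restrict N (u \- w0).
    split; first exact: bessel_domB.
    apply/colP => k; move/colP/(_ k) : Ju; move/colP/(_ k) : Jw0.
    by rewrite !mxE /= => -> ->; rewrite subrr.
  have wuw0 : bessel_form_lam lam w u = bessel_form_lam lam w w0.
    have := ow _ kuw0; rewrite bessel_form_lamC (bessel_form_lamBl lam du dw0 dw).
    by rewrite (bessel_form_lamC lam u) (bessel_form_lamC lam w0) => /eqP; rewrite subr_eq0 => /eqP.
  rewrite (uwv w)// (bessel_form_lamC lam u) wuw0 (uwv w0)//.
  by rewrite bessel_form_lamC EJ.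
rewrite /trace_lam; apply: xget_subset1; last by move=> e e' /val -> /val ->.
exists w0, w0; split => //; last by rewrite EJ.
split => // v [dv _]; rewrite (_ : w0 \- w0 = fun=> 0) ?bessel_form_lam0l//.
by apply/funext => x /=; rewrite subrr.
Qed.

(** The limit is the Green function [1 / max(x, k)] of the form without mass
    term, finite because the three-dimensional Bessel process is transient. *)
Lemma green_cvg0 (s : nat -> R) (k x : R) : 0 < k -> 0 < x ->
  (forall n, s n != 0) -> s n @[n --> \oo] --> 0 ->
  green (s n) k x @[n --> \oo] --> (Num.max x k)^-1.
Proof.
move=> k0 x0 s0 sc; set m := Num.min x k; set M := Num.max x k.
have mM : m * M = x * k by rewrite /m /M minEle maxEle; case: ifP => // _; rewrite mulrC.
have m0 : 0 < m by rewrite lt_min x0.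
have M0 : 0 < M by rewrite lt_max x0.
(* As a function of [s], [sinh (s m)] has derivative [m] at [0]. *)
have := is_derive_cvg (is_derive_expsol m 2^-1 (- 2^-1) 0).
move=> /cvgr_dnbhsP/(_ s (conj s0 sc)) c1.
have c2 : expR (- M * s n) @[n --> \oo] --> expR (- M * 0).
  apply: (cvg_comp (fun n => - M * s n) expR); last exact: continuous_expR.
  by apply: cvgM => //; exact: cvg_cst.
have c3 := cvgM (cvgM c1 c2) (@cvg_cst _ (x * k)^-1 nat \oo _).
have <- : expsol m (m / 2) (- m * - 2^-1) 0 * expR (- M * 0) * (x * k)^-1 = M^-1.
  by rewrite -mM /expsol !mulr0 expR0; field; rewrite !gt_eqF.
apply: (cvg_trans _ (c3 _ _ _)); apply: near_eq_cvg; apply: nearW => n /=.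
rewrite /green -/m -/M /expsol /GRing.scale/= addr0 !mulr0 expR0.
have -> : m * s n = s n * m by rewrite mulrC.
have -> : - m * s n = - s n * m by ring.
have -> : - M * s n = - s n * M by ring.
by field; rewrite s0 !gt_eqF.
Qed.

End trace.

(** * The limit form and the inverse of its matrix *)

Section chain_form.
Context {R : realType}.
Variable n : nat.
Implicit Types (f g h : 'cV[R]_n.+1).

Definition chain_form f g : R :=
  \sum_(1 <= k < n.+1) (k * k.+1)%:R *
    ((f (inord k) 0 - f (inord k.-1) 0) * (g (inord k) 0 - g (inord k.-1) 0)) +
  n.+1%:R * (f ord_max 0 * g ord_max 0).

Lemma chain_formC f g : chain_form f g = chain_form g f.
Proof.
rewrite /chain_form [f ord_max 0 * _]mulrC; congr (_ + _).
by apply: eq_bigr => k _; congr (_ * _); exact: mulrC.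
Qed.

(** The form with its second argument fixed, as a linear map of the first one. *)
Definition chain_formr g f := chain_form f g.

Lemma chain_formr_linear g : linear_for *%R (chain_formr g).
Proof.
move=> c f h; rewrite /chain_formr /chain_form !mxE mulrDr mulr_sumr addrACA -big_split/=.
by congr (_ + _); [apply: eq_bigr => k _; rewrite !mxE|]; ring.
Qed.

HB.instance Definition _ g := GRing.isLinear.Build R 'cV[R]_n.+1 R *%R
  (chain_formr g) (chain_formr_linear g).

Definition chain_mx : 'M[R]_n.+1 :=
  \matrix_(i, j) chain_form (delta_mx i 0) (delta_mx j 0).

Let col_sum f : f = \sum_i f i 0 *: delta_mx i 0.
Proof.
rewrite {1}[f]matrix_sum_delta; apply: eq_bigr => i _.
by rewrite big_ord1.
Qed.

Lemma chain_form_mx f g : chain_form f g = \sum_i f i 0 * (chain_mx *m g) i 0.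
Proof.
rewrite -/(chain_formr g f) {1}[f]col_sum linear_sum/=; apply: eq_bigr => i _.
rewrite linearZ/=; congr (_ * _); rewrite /chain_formr chain_formC.
rewrite -/(chain_formr (delta_mx i 0) g) {1}[g]col_sum linear_sum/= mxE.
by apply: eq_bigr => j _; rewrite linearZ/= mulrC /chain_formr chain_formC mxE.
Qed.

Definition invmax_mx : 'M[R]_n.+1 := \matrix_(i, j) (Num.max i.+1%:R j.+1%:R)^-1.

(** The [l]-th column of [invmax_mx] is constant up to [l] and equal to
    [1 / (k + 1)] from [l] on, with increments [- 1 / (k (k + 1))] that cancel
    the conductances; the form telescopes.  Hence the columns of [invmax_mx]
    are the reproducing vectors of the form, and the two matrices are inverse
    to each other. *)
Lemma chain_form_invmax l g : chain_form (col l invmax_mx) g = g l 0.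
Proof.
pose G k := g (inord k) 0.
rewrite /chain_form (@big_cat_nat _ _ _ l.+1)//=.
rewrite big_nat big1 ?add0r => [|k /andP[k1 kl]]; last first.
  have kn : (k < n.+1)%N by rewrite (leq_trans kl).
  rewrite !mxE !inordK//; last by rewrite (leq_ltn_trans (leq_pred k)).
  rewrite !max_r ?ler_nat ?prednK//; last by rewrite ltnS in kl; exact: ltnW.
  by rewrite subrr mul0r mulr0.
rewrite big_add1 /= big_nat.
rewrite (eq_bigr (fun k => - (G k.+1 - G k))) => [|k /andP[lk kn]]; last first.
  rewrite !mxE /= !inordK//; last exact: ltnW.
  rewrite !max_l ?ler_nat//; last exact: ltnW.
  rewrite natrM -/(G k.+1) -/(G k) -[k.+2%:R]natr1.
  have k0 := ler0n R k; field; apply/andP; split; apply: lt0r_neq0; lra.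
transitivity (\sum_(l <= k < n) - (G k.+1 - G k) + n.+1%:R * (col l invmax_mx ord_max 0 * g ord_max 0)).
  by rewrite [in RHS]big_nat.
rewrite sumrN telescope_sumr; last by rewrite -ltnS.
rewrite !mxE /= max_l ?ler_nat// mulrA divff ?pnatr_eq0// mul1r.
rewrite (_ : ord_max = inord n) -/(G n) ?opprB ?subrK /G ?inord_val//.
by apply/val_inj; rewrite /= inordK.
Qed.

Lemma invmax_mxK : invmax_mx *m chain_mx = 1%:M.
Proof.
apply/matrixP => l j.
have <- : chain_form (col l invmax_mx) (delta_mx j 0) = 1%:M l j.
  by rewrite chain_form_invmax !mxE eqxx andbT.
rewrite chain_form_mx mxE; apply: eq_bigr => k _.
by rewrite -colE !mxE maxC.
Qed.

Lemma invmax_mx_unit : invmax_mx \in unitmx.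
Proof. by case: (mulmx1_unit invmax_mxK). Qed.

Lemma invmx_invmax_mx : invmx invmax_mx = chain_mx.
Proof. by rewrite -[RHS](mulKmx invmax_mx_unit) invmax_mxK mulmx1. Qed.

End chain_form.

(** * The Mosco limit *)

Section mosco.
Context {R : realType}.
Variable n : nat.
Implicit Types (f g h : 'cV[R]_n.+1) (lam : nat -> R).

(** Convergence of the trace forms along any convergent sequence of vectors is
    the continuity of matrix inversion at [invmax_mx]. *)
Lemma trace_lam_cvg lam (f_ : nat -> 'cV[R]_n.+1) f :
  (forall m, 0 < lam m) -> lam m @[m --> \oo] --> 0 ->
  (forall k, f_ m k 0 @[m --> \oo] --> f k 0) ->
  trace_lam (lam m) (f_ m) @[m --> \oo] --> (chain_form f f)%:E.
Proof.
(* The measure is [2 x^2 dx], so the radial equation at [lam] has [s^2 = 2 lam]. *)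
move=> lam0 lamc fc; pose s m := Num.sqrt (2 * lam m).
have s0 m : 0 < s m by rewrite sqrtr_gt0 mulr_gt0.
have slam m : s m ^+ 2 = 2 * lam m by rewrite sqr_sqrtr// mulr_ge0// ltW.
have sc : s m @[m --> \oo] --> 0.
  rewrite -(sqrtr0 R); apply: (cvg_comp (fun m => 2 * lam m) Num.sqrt); last exact: sqrt_continuous.
  by rewrite -(mulr0 2); apply: cvgM => //; exact: cvg_cst.
have Gc : entry_cvg (F := \oo) (fun m => green_mx n.+1 (s m)) (invmax_mx n).
  move=> i j; rewrite mxE; under eq_fun do rewrite mxE.
  by rewrite maxC; apply: green_cvg0 => // m; rewrite gt_eqF.
have [uG iGc] := entry_cvg_invmx Gc (invmax_mx_unit n).
have fc' : entry_cvg (F := \oo) f_ f by move=> i j; rewrite ord1.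
have qc := entry_cvgM iGc fc'.
have : \sum_(k < n.+1) (invmx (green_mx n.+1 (s m)) *m f_ m) k 0 * f_ m k 0 @[m --> \oo] -->
    chain_form f f.
  rewrite chain_form_mx; apply: cvg_sumr => k _; rewrite mulrC.
  apply: cvgM; last exact: fc.
  by rewrite -invmx_invmax_mx; exact: qc.
set q := fun m => _ => qf.
have c : (q m)%:E @[m --> \oo] --> (chain_form f f)%:E.
  by apply: cvg_EFin; [exact: nearW|exact: qf].
apply: (cvg_trans _ c).
apply: near_eq_cvg; apply: filterS uG => m um /=.
by rewrite (trace_lamE _ (s0 m) (slam m) um).
Qed.

Variable a : 'I_n.+1 -> R.
Hypothesis a_gt0 : forall k, 0 < a k.

Lemma dotmu_delta h k : dotmu a h (delta_mx k 0) = a k * h k 0.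
Proof.
rewrite /dotmu (bigD1 k)//= big1 ?addr0 => [|i ik]; first by rewrite mxE !eqxx mulr1.
by rewrite mxE (negbTE ik) mulr0 mulr0.
Qed.

Lemma weak_cvg_entry (f_ : nat -> 'cV[R]_n.+1) f : weak_cvg a \oo f_ f ->
  forall k, f_ m k 0 @[m --> \oo] --> f k 0.
Proof.
move=> fc k.
have ak : a k != 0 by rewrite gt_eqF.
have c : (a k)^-1 * dotmu a (f_ m) (delta_mx k 0) @[m --> \oo] -->
    (a k)^-1 * dotmu a f (delta_mx k 0).
  by apply: cvgM; [exact: cvg_cst|exact: fc].
move: c; rewrite dotmu_delta mulKf//; apply: cvg_trans; apply: near_eq_cvg; apply: nearW => m /=.
by rewrite dotmu_delta mulKf.
Qed.

Lemma strong_cvg_entry {T : Type} {F : set_system T} {FF : Filter F}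
    (f_ : T -> 'cV[R]_n.+1) f :
  strong_cvg a F f_ f -> forall k, f_ x k 0 @[x --> F] --> f k 0.
Proof.
move=> fc k; apply/subr_cvg0/norm_cvg0P.
have : Num.sqrt ((a k)^-1 * dotmu a (f_ x - f) (f_ x - f)) @[x --> F] --> 0.
  rewrite -(sqrtr0 R).
  apply: (cvg_comp (fun x => (a k)^-1 * dotmu a (f_ x - f) (f_ x - f)) Num.sqrt);
    last exact: sqrt_continuous.
  by rewrite -(mulr0 (a k)^-1); apply: cvgM => //; exact: cvg_cst.
apply: squeeze_cvgr; last exact: cvg_cst.
apply: nearW => x; rewrite normr_ge0/= -sqrtr_sqr ler_wsqrtr//.
rewrite ler_pdivlMl// /dotmu (bigD1 k)//= !mxE -expr2 lerDl sumr_ge0// => i _.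
by rewrite !mxE mulr_ge0 ?(ltW (a_gt0 i))// -expr2 sqr_ge0.
Qed.

Lemma entry_strong_cvg {T : Type} {F : set_system T} {FF : Filter F}
    (f_ : T -> 'cV[R]_n.+1) f :
  (forall k, f_ x k 0 @[x --> F] --> f k 0) -> strong_cvg a F f_ f.
Proof.
move=> fc.
have c : \sum_(k < n.+1) a k * ((f_ x k 0 - f k 0) * (f_ x k 0 - f k 0)) @[x --> F] -->
    \sum_(k < n.+1) a k * ((f k 0 - f k 0) * (f k 0 - f k 0)).
  apply: cvg_sumr => k _; apply: cvgM; first exact: cvg_cst.
  by apply: cvgM; apply: cvgB => //; exact: cvg_cst.
move: c; rewrite [X in _ --> X]big1 => [|k _]; last by rewrite subrr !mulr0.
apply: cvg_trans; apply: near_eq_cvg; apply: nearW => x.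
by apply: eq_bigr => k _; rewrite !mxE.
Qed.

(** In finite dimension weak and strong convergence both amount to convergence
    of the entries, so [trace_lam_cvg] supplies both halves of Mosco
    convergence, with constant recovery sequences. *)
Lemma mosco_lim0_chain_form :
  mosco_lim0 a (@trace_lam R n.+1) (fun f => (chain_form f f)%:E).
Proof.
move=> lam lam0 lamc; split=> [f_ f /weak_cvg_entry fc|f].
  by rewrite (cvg_limn_einf_sup (trace_lam_cvg lam0 lamc fc)).
exists (fun=> f); split; first by apply: entry_strong_cvg => k; exact: cvg_cst.
have c := @trace_lam_cvg lam (fun=> f) f lam0 lamc (fun k => cvg_cst _).
by rewrite (cvg_limn_einf_sup (c _)).
Qed.

(** A Mosco limit is unique: testing with the constant sequence bounds it above,
    testing with its own recovery sequences bounds it below. *)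
Lemma trace_formE : trace_form a = (fun f => (chain_form f f)%:E).
Proof.
apply: xget_subset1; first exact: mosco_lim0_chain_form.
suff uniq E : mosco_lim0 a (@trace_lam R n.+1) E -> E = (fun f => (chain_form f f)%:E).
  by move=> E E' /uniq -> /uniq ->.
move=> mE; apply/funext => f.
pose lam m : R := m.+1%:R^-1.
have lam0 m : 0 < lam m by rewrite invr_gt0.
have [low up] := mE lam lam0 cvg_harmonic.
have fcst : weak_cvg a \oo (fun=> f) f by move=> g; exact: cvg_cst.
apply/eqP; rewrite eq_le; apply/andP; split.
  have := low _ _ fcst.
  have c := @trace_lam_cvg lam (fun=> f) f lam0 cvg_harmonic (fun k => cvg_cst _).
  by rewrite (cvg_limn_einf_sup (c _)).
have [f_ [/strong_cvg_entry fc]] := up f.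
by rewrite (cvg_limn_einf_sup (trace_lam_cvg lam0 cvg_harmonic fc)).
Qed.

End mosco.

(** * The matrix exponential *)

Section matrix_exponential.
Context {R : realType}.
Variables (n : nat) (A : 'M[R]_n.+1).
Implicit Types (i j : 'I_n.+1) (s t x : R) (p k : nat).

Let c : R := \sum_i \sum_j `|A i j|.

Let c0 : 0 <= c. Proof. by apply: sumr_ge0 => i _; apply: sumr_ge0. Qed.

Let row_le i : \sum_j `|A i j| <= c.
Proof.
by rewrite /c [leRHS](bigD1 i)//= lerDl sumr_ge0// => k _; apply: sumr_ge0.
Qed.

Lemma expmx_entry_le k i j : `|(A ^+ k) i j| <= c ^+ k.
Proof.
elim: k i j => [|k IH] i j.
  by rewrite !expr0 mxE; case: eqP => _; rewrite ?normr1 ?normr0.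
rewrite exprS mxE (le_trans (ler_norm_sum _ _ _))//.
rewrite (@le_trans _ _ (\sum_l `|A i l| * c ^+ k))//.
  by apply: ler_sum => l _; rewrite normrM ler_wpM2l.
by rewrite -mulr_suml exprS ler_wpM2r ?exprn_ge0.
Qed.

(** Coefficients of the power series of the [p]-th derivative of the exponential. *)
Let coef p i j k : R := (A ^+ (k + p)) i j / k`!%:R.

Let diffs_coef p i j : pseries_diffs (coef p i j) = coef p.+1 i j.
Proof.
apply/funext => k; rewrite /pseries_diffs /coef addSnnS factS natrM.
have kf : (k`!%:R : R) != 0 by rewrite pnatr_eq0 -lt0n fact_gt0.
have kS : (k.+1%:R : R) != 0 by rewrite pnatr_eq0.
by move: kf kS; move: (k.+1%:R : R) (k`!%:R : R) => u v v0 u0; field; rewrite u0 v0.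
Qed.

Let cvg_coef p i j x : cvgn (pseries (coef p i j) x).
Proof.
apply: normed_cvg.
apply: (@series_le_cvg _ _ (fun k => c ^+ p * exp_coeff (c * `|x|) k)).
- by move=> k; exact: normr_ge0.
- by move=> k; rewrite mulr_ge0 ?exprn_ge0// /exp_coeff/= divr_ge0// exprn_ge0// mulr_ge0.
- move=> k /=; rewrite /coef /exp_coeff/= normrM normrX normrM normfV normr_nat.
  rewrite exprMn (_ : c ^+ p * _ = c ^+ (k + p) / k`!%:R * `|x| ^+ k); last first.
    by rewrite exprD; ring.
  by rewrite ler_wpM2r ?exprn_ge0// ler_wpM2r ?invr_ge0// expmx_entry_le.
- by apply: is_cvg_seriesZ; exact: is_cvg_series_exp_coeff.
Qed.

Definition expmx t : 'M[R]_n.+1 := \matrix_(i, j) limn (pseries (coef 0 i j) t).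

Lemma expmx0 : expmx 0 = 1%:M.
Proof.
apply/matrixP => i j; rewrite mxE; apply/cvg_lim => //; apply: cvg_near_cst.
exists 1%N => // -[//|m] _ /=.
rewrite /pseries /series/= big_nat_recl//= big1 => [|k _]; last by rewrite exprS mul0r mulr0.
by rewrite addr0 /coef expr0 expr0 fact0 divr1 mulr1 mxE.
Qed.

Let lim_coef1 i j t :
  limn (pseries (coef 1 i j) t) = (A *m expmx t) i j /\
  limn (pseries (coef 1 i j) t) = (expmx t *m A) i j.
Proof.
split; rewrite mxE; apply: cvg_lim => //.
  rewrite (_ : pseries _ _ = fun m => \sum_l A i l * pseries (coef 0 l j) t m); last first.
    apply/funext => m; rewrite /pseries /series/=.
    under [RHS]eq_bigr do rewrite mulr_sumr.
    rewrite exchange_big/=; apply: eq_bigr => k _.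
    rewrite /coef addn1 addn0 exprS mxE !mulr_suml; apply: eq_bigr => l _; ring.
  apply: cvg_sumr => l _; apply: cvgM; first exact: cvg_cst.
  by rewrite mxE; exact: cvg_coef.
rewrite (_ : pseries _ _ = fun m => \sum_l pseries (coef 0 i l) t m * A l j); last first.
  apply/funext => m; rewrite /pseries /series/=.
  under [RHS]eq_bigr do rewrite mulr_suml.
  rewrite exchange_big/=; apply: eq_bigr => k _.
  rewrite /coef addn1 addn0 exprSr mxE !mulr_suml; apply: eq_bigr => l _; ring.
apply: cvg_sumr => l _; apply: cvgM; last exact: cvg_cst.
by rewrite mxE; exact: cvg_coef.
Qed.

Let is_derive_limn i j t :
  is_derive t 1 (fun x => expmx x i j) (limn (pseries (coef 1 i j) t)).
Proof.
rewrite (_ : (fun x => _) = (fun x => limn (pseries (coef 0 i j) x))); last first.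
  by apply/funext => x; rewrite mxE.
rewrite -diffs_coef; apply: (@pseries_snd_diffs _ _ (`|t| + 1)).
- exact: cvg_coef.
- by rewrite diffs_coef; exact: cvg_coef.
- by rewrite !diffs_coef; exact: cvg_coef.
- by rewrite [ltRHS]ger0_norm ?addr_ge0// ltrDl.
Qed.

Lemma is_derive_expmxl i j t : is_derive t 1 (fun x => expmx x i j) ((A *m expmx t) i j).
Proof. by rewrite -(lim_coef1 i j t).1; exact: is_derive_limn. Qed.

Lemma is_derive_expmxr i j t : is_derive t 1 (fun x => expmx x i j) ((expmx t *m A) i j).
Proof. by rewrite -(lim_coef1 i j t).2; exact: is_derive_limn. Qed.

(** The function [x |-> exp (s + t - x) exp x] has derivative [0]; compare its
    values at [0] and at [t]. *)
Lemma expmxD s t : expmx (s + t) = expmx s *m expmx t.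
Proof.
apply/matrixP => i j.
pose phi x := \sum_l expmx (s + t - x) i l * expmx x l j.
have d0 x : is_derive x 1 phi 0.
  have dsub : is_derive x 1 (fun y => s + t - y) (-1).
    apply: is_derive_eq (is_deriveB (is_derive_cst (s + t) x 1) (is_derive_id x 1)) _.
    by rewrite sub0r.
  have dl l : is_derive x 1 (fun y => expmx (s + t - y) i l * expmx y l j)
      (expmx (s + t - x) i l * (A *m expmx x) l j - (expmx (s + t - x) *m A) i l * expmx x l j).
    have d1 := @is_derive1_comp _ (fun z => expmx z i l) (fun y => s + t - y) x _ _
      (is_derive_expmxr i l (s + t - x)) dsub.
    apply: is_derive_eq (is_deriveM d1 (is_derive_expmxl l j x)) _.
    by rewrite /GRing.scale/=; ring.
  have -> : phi = \sum_l (fun y => expmx (s + t - y) i l * expmx y l j).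
    by apply/funext => y; rewrite fct_sumE.
  apply: is_derive_eq (is_derive_sum dl) _.
  rewrite sumrB; apply/eqP; rewrite subr_eq0; apply/eqP.
  transitivity ((expmx (s + t - x) *m (A *m expmx x)) i j); first by rewrite [RHS]mxE.
  by rewrite mulmxA mxE.
have := @is_derive_0_is_cst _ phi 0 t d0.
rewrite /phi subr0 addrK expmx0 => e.
transitivity ((expmx (s + t) *m 1%:M) i j); first by rewrite mulmx1.
by rewrite [LHS]mxE [RHS]mxE.
Qed.

Lemma expmx_diff_quotient i j :
  t^-1 * (expmx t i j - (1%:M : 'M[R]_n.+1) i j) @[t --> 0^'+] --> A i j.
Proof.
have := is_derive_cvg (is_derive_expmxl i j 0).
rewrite expmx0 mulmx1 => /cvg_dnbhs_at_right.
by under eq_fun do rewrite addr0.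
Qed.

Lemma expmx_cvg0 i j : expmx t i j @[t --> 0^'+] --> (1%:M : 'M[R]_n.+1) i j.
Proof.
rewrite -expmx0; apply: cvg_at_right_filter.
have [/derivable1_diffP/differentiable_continuous + _] := is_derive_expmxl i j 0.
exact.
Qed.

End matrix_exponential.

(** * Semigroup, irreducibility and transience *)

Section chain_form_order.
Context {R : realType}.
Variable n : nat.
Implicit Types (f g h : 'cV[R]_n.+1) (c : R).

Lemma chain_form_ge0 f : 0 <= chain_form f f.
Proof.
by apply: addr_ge0; [apply: sumr_ge0 => k _|]; rewrite mulr_ge0// -expr2 sqr_ge0.
Qed.

Lemma chain_formDl c f g h : chain_form (c *: f + g) h = c * chain_form f h + chain_form g h.
Proof. exact: (chain_formr_linear h c f g). Qed.

Lemma chain_formDr c f g h : chain_form h (c *: f + g) = c * chain_form h f + chain_form h g.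
Proof. by rewrite chain_formC chain_formDl !(chain_formC h). Qed.

(** Positivity of the form at [f - f_l gamma], where [gamma] is the
    reproducing vector of the coordinate [l], whose energy is [1 / l.+1 <= 1]. *)
Lemma sqr_le_chain_form f l : f l 0 ^+ 2 <= chain_form f f.
Proof.
have := chain_form_ge0 (- f l 0 *: col l (invmax_mx n) + f).
rewrite chain_formDl !chain_formDr chain_form_invmax (chain_formC f).
rewrite chain_form_invmax !mxE maxxx.
have : (l.+1%:R : R)^-1 <= 1 by rewrite invf_le1// ler1n.
have := sqr_ge0 (f l 0); set x := f l 0; set E := chain_form f f; set y := _^-1.
by rewrite expr2; nra.
Qed.

Lemma polar_chain_form f g :
  polar (fun u : 'cV[R]_n.+1 => (chain_form u u)%:E) f g = chain_form f g.
Proof.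
have e1 : f + g = 1 *: g + f by rewrite scale1r addrC.
have e2 : f - g = -1 *: g + f by rewrite scaleN1r addrC.
rewrite /polar /= e1 e2.
by rewrite !chain_formDl !chain_formDr (chain_formC g f); field.
Qed.

End chain_form_order.

Section chain_semigroup.
Context {R : realType}.
Variables (n : nat) (a : 'I_n.+1 -> R).
Hypothesis a_gt0 : forall k, 0 < a k.
Implicit Types (f g h : 'cV[R]_n.+1) (s t : R) (T : R -> 'M[R]_n.+1).

Let E f := (chain_form f f)%:E.

(** The operator of the form with respect to [dotmu a]. *)
Definition chain_gen : 'M[R]_n.+1 := \matrix_(i, j) ((a i)^-1 * chain_mx n i j).

Lemma chain_genE f i : (chain_gen *m f) i 0 = (a i)^-1 * (chain_mx n *m f) i 0.
Proof. by rewrite !mxE mulr_sumr; apply: eq_bigr => j _; rewrite mxE mulrA. Qed.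

Lemma dotmu_chain_gen f g : dotmu a (chain_gen *m f) g = chain_form f g.
Proof.
rewrite chain_formC chain_form_mx; apply: eq_bigr => k _.
rewrite chain_genE -[g k 0 * _]mulrC !mulrA divff ?mul1r// gt_eqF//.
Qed.

Lemma form_dom_chain : form_dom E = [set: 'cV[R]_n.+1].
Proof. by apply/seteqP; split => // f _; rewrite /form_dom /= ltry. Qed.

Lemma form_op_chain f h : form_op a E f h <-> h = chain_gen *m f.
Proof.
split=> [[_ H]|->]; last first.
  split; first by rewrite form_dom_chain.
  by move=> g _; rewrite polar_chain_form dotmu_chain_gen.
apply/colP => k; have := H (delta_mx k 0); rewrite form_dom_chain => /(_ I).
rewrite polar_chain_form -dotmu_chain_gen !dotmu_delta => /mulfI ->//.
by rewrite gt_eqF.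
Qed.

Lemma chain_semigroup_exists : is_form_semigroup a E (expmx (- chain_gen)).
Proof.
have cvgT f k : (expmx (- chain_gen) t *m f) k 0 @[t --> 0^'+] --> f k 0.
  have -> : f k 0 = (1%:M *m f) k 0 by rewrite mul1mx.
  rewrite mxE; under eq_fun do rewrite mxE.
  by apply: cvg_sumr => l _; apply: cvgM; [exact: expmx_cvg0|exact: cvg_cst].
have cvgL f k : (t^-1 *: (f - expmx (- chain_gen) t *m f)) k 0 @[t --> 0^'+] -->
    (chain_gen *m f) k 0.
  rewrite mxE.
  have c : \sum_l - (t^-1 * (expmx (- chain_gen) t k l - (1%:M : 'M[R]_n.+1) k l)) * f l 0
      @[t --> 0^'+] --> \sum_l - (- chain_gen) k l * f l 0.
    apply: cvg_sumr => l _; apply: cvgM; last exact: cvg_cst.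
    by apply: cvgN; exact: expmx_diff_quotient.
  rewrite (eq_bigr (fun l => - (- chain_gen) k l * f l 0)); last by move=> l _; rewrite [(- chain_gen) _ _]mxE opprK.
  apply: (cvg_trans _ c); apply: near_eq_cvg; apply: nearW => t.
  have -> : f - expmx (- chain_gen) t *m f = - ((expmx (- chain_gen) t - 1%:M) *m f).
    by rewrite mulmxBl mul1mx opprB.
  have entryE (B : 'M[R]_n.+1) :
      (t^-1 *: - (B *m f)) k 0 = t^-1 * - (\sum_l B k l * f l 0) by rewrite !mxE.
  rewrite entryE mulrN mulr_sumr -sumrN.
  have subE (B C : 'M[R]_n.+1) l : (B - C) k l = B k l - C k l by rewrite !mxE.
  by apply: eq_bigr => l _; rewrite subE; ring.
split.
- exact: expmx0.
- by move=> s t _ _; exact: expmxD.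
- by move=> f; exact: entry_strong_cvg.
- move=> f h; rewrite form_op_chain; split=> [->|/(strong_cvg_entry a_gt0) fh].
    exact: entry_strong_cvg.
  by apply/colP => k; exact: cvg_unique (fh k) (cvgL f k).
Qed.

Lemma chain_form_semigroup : is_form_semigroup a E (form_semigroup a E).
Proof. by apply: xgetPex; exists (expmx (- chain_gen)); exact: chain_semigroup_exists. Qed.

Lemma semigroup_diff_quotient T (sT : is_form_semigroup a E T) f k :
  (t^-1 *: (f - T t *m f)) k 0 @[t --> 0^'+] --> (chain_gen *m f) k 0.
Proof.
have [_ _ _ gen] := sT; apply: (strong_cvg_entry a_gt0).
by apply/gen/form_op_chain.
Qed.

(** A multiplication that commutes with the semigroup commutes with its
    generator: pass to the limit in the difference quotients. *)
Lemma mul_indic_chain_gen T (Y : {set 'I_n.+1}) f : is_form_semigroup a E T ->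
  (forall t, 0 < t -> T t *m mul_indic Y f = mul_indic Y (T t *m f)) ->
  chain_gen *m mul_indic Y f = mul_indic Y (chain_gen *m f).
Proof.
move=> sT TY; apply/colP => k.
have c1 := @semigroup_diff_quotient T sT (mul_indic Y f) k.
have c2 : (if k \in Y then 1 else 0) * (t^-1 *: (f - T t *m f)) k 0 @[t --> 0^'+] -->
    (if k \in Y then 1 else 0) * (chain_gen *m f) k 0.
  by apply: cvgM; [exact: cvg_cst|exact: semigroup_diff_quotient].
rewrite [RHS]mxE (_ : (if _ then _ else _) =
  (if k \in Y then 1 else 0) * (chain_gen *m f) k 0); last first.
  by case: ifP; rewrite ?mul1r ?mul0r.
apply: cvg_unique c1 _ => //; apply: (cvg_trans _ c2).
apply: near_eq_cvg; near=> t; rewrite TY; last by near: t; exact: nbhs_right_gt.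
by rewrite !mxE; case: ifP => _; rewrite ?mul1r// mul0r subrr mulr0.
Unshelve. all: by end_near. Qed.

(** If [Y] is invariant, the indicators [f] of [Y] and [g] of its complement
    satisfy [E(f, g) = 0].  But [E(f, g)] is minus the sum of the squared
    increments of [f] with positive weights, so [f] is constant. *)
Lemma chain_irreducible : irreducible a E.
Proof.
move=> Y TY; have sT := chain_form_semigroup.
pose f : 'cV[R]_n.+1 := mul_indic Y (const_mx 1).
pose g : 'cV[R]_n.+1 := mul_indic (~: Y) (const_mx 1).
have fE k : f k 0 = if k \in Y then 1 else 0 by rewrite !mxE.
have gE k : g k 0 = 1 - f k 0.
  by rewrite !mxE inE; case: (k \in Y); rewrite /= ?subrr ?subr0.
have Yf : mul_indic Y f = f by apply/colP => k; rewrite !mxE; case: (k \in Y).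
clearbody g f.
have fg0 : chain_form f g = 0.
  rewrite -dotmu_chain_gen -Yf (mul_indic_chain_gen sT (fun t => TY f t)).
  rewrite /dotmu big1// => k _; rewrite [mul_indic _ _ _ _]mxE gE fE.
  by case: (k \in Y); rewrite ?subrr ?mul0r !mulr0.
(* [f] takes only the values [0] and [1]. *)
have ff1 k : f k 0 * (1 - f k 0) = 0.
  by rewrite fE; case: ifP; rewrite ?subrr ?mulr0 ?mul0r.
have sum0 : \sum_(1 <= k < n.+1) (k * k.+1)%:R * (f (inord k) 0 - f (inord k.-1) 0) ^+ 2 = 0.
  apply/eqP; rewrite -oppr_eq0 -sumrN; apply/eqP; rewrite -[RHS]fg0 /chain_form.
  rewrite (gE ord_max) ff1 mulr0 addr0; apply: eq_bigr => k _.
  by rewrite !gE; ring.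
have step (k : nat) : (0 < k)%N -> (k < n.+1)%N -> f (inord k) 0 = f (inord k.-1) 0.
  move=> k1 kn; move: sum0; rewrite big_nat => /eqP.
  rewrite psumr_eq0; last by move=> i _; rewrite mulr_ge0// sqr_ge0.
  move=> /allP/(_ k); rewrite mem_index_iota k1 kn => /(_ isT)/=.
  rewrite mulf_eq0 pnatr_eq0 muln_eq0 sqrf_eq0 subr_eq0 => /orP[|/eqP//].
  by case: k k1 {kn}.
have const k : (k < n.+1)%N -> f (inord k) 0 = f ord0 0.
  elim: k => [|k IH] kn; first by congr (f _ 0); apply/val_inj; rewrite /= inordK.
  by rewrite step// IH// ltnW.
have mem k : (k \in Y) = (ord0 \in Y).
  have := const k (ltn_ord k); rewrite inord_val !fE.
  by case: (k \in Y); case: (ord0 \in Y) => // /eqP; rewrite ?oner_eq0// eq_sym oner_eq0.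
case Y0 : (ord0 \in Y); [right|left]; apply/setP => k; rewrite mem Y0 inE//.
Qed.

(** Every coordinate is bounded by the square root of the energy, so a
    reference function giving the points equal weights [1 / n.+1] works. *)
Lemma chain_transient : transient a E.
Proof.
exists (\col_k (a k * n.+1%:R)^-1); split=> [k|f _].
  by rewrite mxE invr_gt0 mulr_gt0.
rewrite (@le_trans _ _ (\sum_(k < n.+1) n.+1%:R^-1 * Num.sqrt (chain_form f f)))//.
  apply: ler_sum => k _; rewrite mxE invfM mulrCA mulVKf ?gt_eqF// mulrC.
  by rewrite ler_wpM2l ?invr_ge0// -sqrtr_sqr ler_wsqrtr// sqr_le_chain_form.
by rewrite sumr_const card_ord -mulrnAl -[_ *+ _]mulr_natl divff ?pnatr_eq0// mul1r.
Qed.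

End chain_semigroup.

(** * Failure of conservativeness *)

Section chain_not_conservative.
Context {R : realType}.
Variables (n : nat) (a : 'I_n.+1 -> R).
Hypothesis a_gt0 : forall k, 0 < a k.
Implicit Types (f g : 'cV[R]_n.+1) (B : 'M[R]_n.+1) (t r : R).

Let E f := (chain_form f f)%:E.

Lemma chain_form_gt0 f : f != 0 -> 0 < chain_form f f.
Proof.
move=> f0; rewrite lt_neqAle chain_form_ge0 andbT; apply: contra_neq f0 => E0.
apply/colP => k; rewrite mxE; apply/eqP; rewrite -sqrf_eq0 eq_le sqr_ge0 andbT.
by rewrite E0 sqr_le_chain_form.
Qed.

Lemma mulmx_col_le B f r k : (forall l, `|f l 0| <= r) ->
  `|(B *m f) k 0| <= (\sum_l `|B k l|) * r.
Proof.
move=> fr; rewrite mxE (le_trans (ler_norm_sum _ _ _))// mulr_suml.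
by apply: ler_sum => l _; rewrite normrM ler_wpM2l.
Qed.

Variable T : R -> 'M[R]_n.+1.
Hypothesis sT : is_form_semigroup a E T.

(** With [A t = (1 - T t) / t], which tends to the operator [L] of the form,
    [|T t f|^2 = |f|^2 - t (2 <A t f, f> - t |A t f|^2)].  The coordinates of [f]
    are bounded by the square root of [E(f)], so the bracket is at least
    [(2 - 2 p(t) - q(t)) E(f)] where [p] and [q] do not depend on [f] and tend
    to [0]. *)
Lemma semigroup_contracts :
  \forall t \near 0^'+, forall f, f != 0 ->
    dotmu a (T t *m f) (T t *m f) < dotmu a f f.
Proof.
pose A t := t^-1 *: (1%:M - T t).
pose L := chain_gen a.
have Ac k l : A t k l @[t --> 0^'+] --> L k l.
  have := @semigroup_diff_quotient _ _ _ a_gt0 _ sT (delta_mx l 0) k.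
  rewrite -colE [X in _ --> X]mxE; apply: cvg_trans; apply: near_eq_cvg.
  apply: nearW => t; rewrite /A -{1}[delta_mx l 0]mul1mx -mulmxBl.
  by rewrite scalemxAl -colE mxE.
pose p t := \sum_k a k * \sum_l `|A t k l - L k l|.
pose q t := t * \sum_k a k * (\sum_l `|A t k l|) ^+ 2.
have pc : p t @[t --> 0^'+] --> \sum_k a k * \sum_l `|L k l - L k l|.
  apply: cvg_sumr => k _; apply: cvgM; first exact: cvg_cst.
  by apply: cvg_sumr => l _; apply: cvg_norm; apply: cvgB; [exact: Ac|exact: cvg_cst].
have qc : q t @[t --> 0^'+] --> 0 * \sum_k a k * (\sum_l `|L k l|) ^+ 2.
  apply: cvgM; first exact: cvg_at_right_filter.
  apply: cvg_sumr => k _; apply: cvgM; first exact: cvg_cst.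
  have Sc : \sum_l `|A t k l| @[t --> 0^'+] --> \sum_l `|L k l|.
    by apply: cvg_sumr => l _; apply: cvg_norm; exact: Ac.
  by rewrite expr2; under eq_fun do rewrite expr2; apply: cvgM.
have c : 2 * p t + q t @[t --> 0^'+] --> 2 * (\sum_k a k * \sum_l `|L k l - L k l|) +
    0 * (\sum_k a k * (\sum_l `|L k l|) ^+ 2).
  by apply: cvgD => //; apply: cvgM => //; exact: cvg_cst.
move: c; rewrite mul0r addr0 big1 ?mulr0 => [c|k _]; last first.
  by rewrite big1 ?mulr0// => l _; rewrite subrr normr0.
have small : \forall t \near 0^'+, 2 * p t + q t < 2.
  by apply: (cvgr_lt _ c).
near=> t => f f0.
have t0 : 0 < t by near: t; exact: nbhs_right_gt.
have pq : 2 * p t + q t < 2 by near: t.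
have E0 := chain_form_gt0 f0.
pose r := Num.sqrt (chain_form f f).
have r2 : r * r = chain_form f f by rewrite -expr2 sqr_sqrtr// ltW.
have fr l : `|f l 0| <= r by rewrite -sqrtr_sqr ler_wsqrtr// sqr_le_chain_form.
have TE : T t *m f = f - t *: (A t *m f).
  rewrite scalemxAl /A scalerA divff ?gt_eqF// scale1r mulmxBl mul1mx.
  by rewrite opprB addrC subrK.
have AE : A t *m f = L *m f + (A t - L) *m f by rewrite mulmxBl addrC subrK.
pose u := A t *m f; pose w := (A t - L) *m f.
have expand : dotmu a (T t *m f) (T t *m f) =
    dotmu a f f - t * (2 * (chain_form f f + dotmu a w f) - t * dotmu a u u).
  rewrite -(dotmu_chain_gen a_gt0 f f) /dotmu -[X in 2 * X]big_split/=.
  rewrite !mulr_sumr -sumrB mulr_sumr -sumrB.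
  apply: eq_bigr => k _; have /colP/(_ k) := TE; have /colP/(_ k) := AE.
  rewrite -/u -/w; move: (T t *m f) => v.
  by rewrite !mxE => uk ->; rewrite uk; ring.
have wp : `|dotmu a w f| <= p t * chain_form f f.
  rewrite /dotmu /p mulr_suml (le_trans (ler_norm_sum _ _ _))// ler_sum// => k _.
  rewrite !normrM (gtr0_norm (a_gt0 k)) -mulrA ler_wpM2l ?(ltW (a_gt0 k))//.
  rewrite -r2 mulrA ler_pM//.
  rewrite (le_trans (mulmx_col_le _ _ fr))//.
  by rewrite (eq_bigr (fun l => `|A t k l - L k l|))// => l _; rewrite !mxE.
have uq : t * dotmu a u u <= q t * chain_form f f.
  rewrite /q -mulrA ler_wpM2l ?(ltW t0)// /dotmu mulr_suml ler_sum// => k _.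
  rewrite -mulrA ler_wpM2l ?(ltW (a_gt0 k))// -r2.
  rewrite -expr2 -(real_normK (num_real (u k 0))) -expr2 -exprMn.
  rewrite ler_sqr ?nnegrE ?mulr_ge0 ?sumr_ge0 ?sqrtr_ge0//.
  exact: mulmx_col_le.
rewrite expand gtrBl mulr_gt0//.
have := ler_norm (- dotmu a w f); rewrite normrN => h.
have := mulr_gt0 E0 (_ : 0 < 2 - (2 * p t + q t)); rewrite subr_gt0 => /(_ pq).
by nra.
Unshelve. all: by end_near. Qed.

(** Writing [t] as a sum of equal small steps, each step does not increase the
    norm and the first strictly decreases the norm of the constant vector. *)
Lemma semigroup_not_conservative t : 0 < t -> T t *m const_mx 1 <> const_mx 1 :> 'cV[R]_n.+1.
Proof.
move=> t0 T1; have [T0 TD _ _] := sT.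
have [d /= d0 small] := semigroup_contracts.
pose m := Num.truncn (t / d); pose h := t / m.+1%:R.
have h0 : 0 < h by rewrite divr_gt0.
have hd : h < d by rewrite ltr_pdivrMr// mulrC -ltr_pdivrMr// truncnS_gt.
have contr f : f != 0 -> dotmu a (T h *m f) (T h *m f) < dotmu a f f.
  by apply: small => //=; rewrite sub0r normrN gtr0_norm.
have contrW f : dotmu a (T h *m f) (T h *m f) <= dotmu a f f.
  by have [->|/contr/ltW//] := eqVneq f 0; rewrite mulmx0.
have iter f j : dotmu a (T (h * j%:R) *m f) (T (h * j%:R) *m f) <= dotmu a f f.
  elim: j => [|j IH]; first by rewrite mulr0 T0 mul1mx.
  have hj : 0 <= h * j%:R by rewrite mulr_ge0// ltW.
  have -> : h * j.+1%:R = h + h * j%:R by rewrite -natr1 mulrDr mulr1 addrC.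
  rewrite (TD _ _ (ltW h0) hj) -mulmxA.
  exact: le_trans (contrW _) IH.
have one0 : const_mx 1 != 0 :> 'cV[R]_n.+1.
  by apply/eqP => /colP/(_ ord0); rewrite !mxE => /eqP; rewrite oner_eq0.
have := le_lt_trans (iter (T h *m const_mx 1) m) (contr _ one0).
have hm : 0 <= h * m%:R by rewrite mulr_ge0// ltW.
rewrite mulmxA -(TD _ _ hm (ltW h0)).
have -> : h * m%:R + h = t by rewrite -{2}[h]mulr1 -mulrDr natr1 /h mulfVK.
by rewrite T1 ltxx.
Qed.

End chain_not_conservative.

Theorem theorem3p11 (R : realType) (n : nat) (a : 'I_n.+1 -> R)
    (a_gt0 : forall k, 0 < a k) :
  let E := trace_form a in
  [/\ form_dom E = [set: 'cV[R]_n.+1] /\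
      (forall u : 'cV[R]_n.+1,
         E u = (\sum_(1 <= k < n.+1)
                  (k * k.+1)%:R * (u (inord k) 0 - u (inord k.-1) 0) ^+ 2
                + n.+1%:R * u ord_max 0 ^+ 2)%:E),
      transient a E /\ irreducible a E &
      ~ conservative a E].
Proof.
rewrite /= (trace_formE a_gt0); split.
- split; first exact: form_dom_chain.
  by move=> u; congr EFin; rewrite expr2; congr (_ + _); apply: eq_bigr => k _; rewrite expr2.
- by split; [exact: chain_transient|exact: chain_irreducible].
- move=> [t t0]; apply: (@semigroup_not_conservative _ _ _ a_gt0 _ _ _ t0).
  exact: chain_form_semigroup.
Qed.
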